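(* Let $C(x,\rho)$ and $S(x,\rho)$ be the $m\times m$ matrix solutions of $$Y''+(\rho^2 I+2i\rho Q_1(x)+Q_0(x))Y=0,\quad x\in(0,\pi),$$ with initial conditions $C(0,\rho)=S'(0,\rho)=I$, $C'(0,\rho)=S(0,\rho)=0$. Then for $x\in[0,\pi]$, $\nu=0,1$, as $|\rho|\to\infty$ ($\rho\in\mathbb{C}$), $$C^{(\nu)}(x,\rho)=\frac{(i\rho)^{\nu}}{2}\exp(i\rho x)P_-(x)+\frac{(-i\rho)^{\nu}}{2}\exp(-i\rho x)P_+(x)+O\bigl(\rho^{\nu-1}\exp(|\tau|x)\bigr),$$ $$S^{(\nu)}(x,\rho)=\frac{(i\rho)^{\nu-1}}{2}\exp(i\rho x)P_-(x)+\frac{(-i\rho)^{\nu-1}}{2}\exp(-i\rho x)P_+(x)+O\bigl(\rho^{\nu-2}\exp(|\tau|x)\bigr),$$ where $\tau:=\operatorname{Im}\rho$ and the constants in the $O$-terms do not depend on $x$ and $\rho$.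
   Context: Here $m\ge1$, $I$ is the $m\times m$ unit matrix, $\rho\in\mathbb{C}$ is the spectral parameter, and $Q_s(x)$ ($s=0,1$) are $m\times m$ complex matrix functions with entries in $W_1^s[0,\pi]$ (so the entries of $Q_1$ are absolutely continuous on $[0,\pi]$ with integrable derivative, and the entries of $Q_0$ are integrable). Derivatives $^{(\nu)}$ and $'$ are with respect to $x$. The $m\times m$ matrix functions $P_+(x)$, $P_-(x)$ are the solutions of the Cauchy problems $$P_{\pm}'(x)=\pm Q_1(x)P_{\pm}(x),\qquad P_{\pm}(0)=I.$$ An estimate $O(\cdot)$ for a matrix is understood in a matrix norm. *)

(* Defs.v *)
From HB Require Import structures.
From mathcomp Require Import all_boot all_order all_algebra.
From mathcomp Require Import all_classical all_reals all_analysis.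
From mathcomp Require Import complex.

Set Implicit Arguments.
Unset Strict Implicit.
Unset Printing Implicit Defensive.

Import Order.TTheory GRing.Theory Num.Theory.
Import numFieldNormedType.Exports.
Import ComplexField.Normc.

Local Open Scope classical_set_scope.
Local Open Scope complex_scope.
Local Open Scope ring_scope.

Definition I0pi {R : realType} : set R := `[0, pi].

(* The punctured filter is taken within [0, pi], so that derivatives at the
   end points 0 and pi are one-sided. *)
Definition diffquo (R : realType) (f : R -> R) (x : R) :=
  (fun y => (f y - f x) / (y - x)) @ within I0pi x^'.

Definition cderivable (R : realType) (f : R -> R[i]) (x : R) : Prop :=
  cvg (diffquo (fun t => complex.Re (f t)) x) /\
  cvg (diffquo (fun t => complex.Im (f t)) x).

Definition cderive (R : realType) (f : R -> R[i]) (x : R) : R[i] :=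
  lim (diffquo (fun t => complex.Re (f t)) x) +i*
  lim (diffquo (fun t => complex.Im (f t)) x).

(* Absolute continuity on [0, pi]. *)
Definition abs_continuous (R : realType) (f : R -> R[i]) : Prop :=
  forall e : R, 0 < e -> exists2 d : R, 0 < d &
    forall (n : nat) (a b : 'I_n -> R),
      (forall k, [/\ 0 <= a k, a k <= b k & b k <= pi]) ->
      trivIset setT (fun k => `]a k, b k[%classic) ->
      \sum_(k < n) (b k - a k) < d ->
      \sum_(k < n) normc (f (b k) - f (a k)) < e.

(* Integrability in the library includes Borel measurability; passing to an
   almost everywhere equal function recovers the Lebesgue measurable case. *)
Definition L1 (R : realType) (f : R -> R[i]) : Prop :=
  exists g : R -> R[i],
    [/\ (@lebesgue_measure R).-integrable I0pi (fun x => (complex.Re (g x))%:E),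
        (@lebesgue_measure R).-integrable I0pi (fun x => (complex.Im (g x))%:E) &
        {ae @lebesgue_measure R, forall x, I0pi x -> f x = g x}].

(* The space W_1^s[0, pi]; W_1^0[0, pi] is L_1(0, pi). *)
Fixpoint W1 (R : realType) (s : nat) (f : R -> R[i]) : Prop :=
  if s is s'.+1 then
    [/\ abs_continuous f,
        {ae @lebesgue_measure R, forall x, I0pi x -> cderivable f x} &
        W1 s' (cderive f)]
  else L1 f.

Definition entry (R : realType) (m : nat) (F : R -> 'M[R[i]]_m) (i j : 'I_m)
  : R -> R[i] := fun x => F x i j.

Definition mxderivable (R : realType) (m : nat) (F : R -> 'M[R[i]]_m) (x : R)
  : Prop := forall i j, cderivable (entry F i j) x.

Definition mxderive (R : realType) (m : nat) (F : R -> 'M[R[i]]_m) (x : R)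
  : 'M[R[i]]_m := \matrix_(i, j) cderive (entry F i j) x.

Definition mxderiven (R : realType) (m nu : nat) (F : R -> 'M[R[i]]_m)
  : R -> 'M[R[i]]_m := iter nu (@mxderive R m) F.

Definition is_cauchy_solution (R : realType) (m : nat)
    (A P : R -> 'M[R[i]]_m) : Prop :=
  P 0 = 1%:M /\
  forall x, I0pi x -> mxderivable P x /\ mxderive P x = A x *m P x.

(* Caratheodory solutions: Y is differentiable with Y' absolutely continuous,
   and the equation holds almost everywhere. *)
Definition is_pencil_solution (R : realType) (m : nat)
    (Q1 Q0 : R -> 'M[R[i]]_m) (rho : R[i]) (Y : R -> 'M[R[i]]_m) : Prop :=
  [/\ forall x, I0pi x -> mxderivable Y x,
      forall i j, abs_continuous (entry (mxderive Y) i j) &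
      {ae @lebesgue_measure R, forall x, `]0, pi[%classic x ->
        mxderivable (mxderive Y) x /\
        mxderiven 2 Y x +
          ((rho ^+ 2)%:M + (2 * 'i%C * rho) *: Q1 x + Q0 x) *m Y x = 0}].

Definition cexp (R : realType) (z : R[i]) : R[i] :=
  (expR (complex.Re z) * cos (complex.Im z)) +i*
  (expR (complex.Re z) * sin (complex.Im z)).

(* The operator norm induced by the sup norm on C^m. *)
Definition mxnorm (R : realType) (m : nat) (A : 'M[R[i]]_m) : R :=
  \big[Num.max/0]_(i < m) \sum_(j < m) normc (A i j).

(* F(x, rho) = O(g(x, rho)) as |rho| -> oo, uniformly in x in [0, pi]. *)
Definition bigO_unif (R : realType) (m : nat) (F : R -> R[i] -> 'M[R[i]]_m)
    (g : R -> R[i] -> R) : Prop :=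
  exists K r : R, forall (rho : R[i]) (x : R),
    r <= normc rho -> I0pi x -> mxnorm (F x rho) <= K * g x rho.

(* Main.v *)
(* With k = i rho, split a solution as Y = u + v and Y' = k (u - v).  Then
    u' = k u - Q1 (u + v) - Q0 (u + v) / (2 k) and
    v' = - k v + Q1 (u + v) + Q0 (u + v) / (2 k).  The off-diagonal terms
    -Q1 v and Q1 u are nonresonant: since Q1 is absolutely continuous, the
    substitution u - Q1 v / (2 k), v - Q1 u / (2 k) removes them up to terms of
    order 1/rho with an integrable coefficient.  After subtracting
    al exp(k x) P_- and be exp(-k x) P_+, which solve the diagonal system, and
    multiplying by exp(-|tau| x), the real parts of the diagonal coefficients
    k - |tau| and - k - |tau| are nonpositive, so the squared Frobenius norm E
    of the remainder satisfies E' <= f (E + (c / |rho|)^2) with f integrable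
    and independent of rho; Gronwall's inequality gives E = O((c / |rho|)^2). *)

Require Import Defs.
From mathcomp Require Import all_boot all_order all_algebra.
From mathcomp Require Import all_classical all_reals all_analysis.
From mathcomp Require Import complex ring lra.

Set Implicit Arguments.
Unset Strict Implicit.
Unset Printing Implicit Defensive.

Import Order.TTheory GRing.Theory Num.Theory.
Import numFieldNormedType.Exports.
Import ComplexField.Normc.

Local Open Scope complex_scope.
Local Open Scope ring_scope.

(** * Absolutely continuous functions and Gronwall's inequality *)

(** The obstacle is that Q1 comes with a factor rho, so in the system for u and v it is of order 1,
    not small. Its diagonal part produces P_- and P_+. Its off-diagonal part can be removed because
    the rates k and -k differ by 2k: adding - Q1 v / (2 k) to u changes u' - k u by (k + k) Q1 v /
    (2 k) = Q1 v, up to terms with a factor 1 / k. Uniformity in complex rho comes from using an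
    energy instead of integral equations: the derivative of the squared norm sees only the real
    parts of k - |tau| and - k - |tau|, so the size of k never enters Gronwall's constant. Since Q0
    and Q1' are merely integrable, the differential inequalities hold almost everywhere only, and
    absolute continuity is what allows integrating them. C and S are treated together as Y(0) = (al
    + be) I, Y'(0) = k (al - be) I, that is u(0) = al I, v(0) = be I. With c = |al| + |be|, c = 1
    for C and c = 1 / |rho| for S; the derivative costs one factor |rho| because Y' = k (u - v). *)

Section AbsoluteContinuity.
Context {R : realType}.
Implicit Types (f g : R -> R) (s : seq (R * R)).
Local Notation mu := (@lebesgue_measure R).

(** Compactness of [a, b] as an induction principle: the supremum of the points reachable from [a]
    is itself reachable and cannot lie before [b]. The small intervals contain their tag [x], so an
    increment over one of them can be split at the tag. *)
Lemma cousin (P : R -> R -> Prop) (a b : R) : a <= b ->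
  (forall x y z, P x y -> P y z -> P x z) ->
  (forall x, a <= x <= b -> exists2 d : R, 0 < d &
     forall y z, a <= y -> y <= x -> x <= z -> z <= b ->
       x - d < y -> z < x + d -> P y z) ->
  P a b.
Proof.
move=> ab Ptrans Ploc.
pose T := [set y | a <= y <= b /\ P a y]%classic.
have Ta : T a.
  split; first by rewrite lexx ab.
  have [|d d0 h] := Ploc a; first by rewrite lexx ab.
  by apply: h => //; lra.
have ubT : ubound T b by move=> y [/andP[]].
have supT : has_sup T by split; [exists a|exists b].
set c := sup T.
have cb : c <= b by apply: ge_sup => //; exists a.
have ac : a <= c by exact: (ub_le_sup (ex_intro _ b ubT) Ta).
have [|d d0 h] := Ploc c; first by rewrite ac cb.
have [t [/andP[at_ tb] Pat] ct] := sup_adherent d0 supT.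
have tc : t <= c by apply: (ub_le_sup (ex_intro _ b ubT)); split=> //; rewrite at_ tb.
have Pac : P a c.
  by apply: Ptrans Pat _; apply: h => //; rewrite -/c in ct *; lra.
have [cb'|bc] := ltP c b; last by have <- : c = b by apply/eqP; rewrite eq_le cb bc.
pose y := Num.min b (c + d / 2).
have cy : c < y by rewrite lt_min cb'/=; lra.
have Ty : T y.
  have yb : y <= b by rewrite ge_min lexx.
  split; first by rewrite yb andbT; lra.
  apply: Ptrans Pac _; apply: h => //; try lra.
  by apply: (@le_lt_trans _ _ (c + d / 2)); [rewrite ge_min lexx orbT|lra].
by have := ub_le_sup (ex_intro _ b ubT) Ty; rewrite -/c leNgt cy.
Qed.

Fixpoint packed (x : R) s (y : R) : bool :=
  if s is p :: s' then [&& x <= p.1, p.1 <= p.2 & packed p.2 s' y] else x <= y.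

(* Absolute continuity, with the disjoint intervals listed in increasing order. *)
Definition rac f := forall e : R, 0 < e -> exists2 d : R, 0 < d &
  forall s, packed 0 s pi -> \sum_(p <- s) (p.2 - p.1) < d ->
    \sum_(p <- s) `|f p.2 - f p.1| < e.

(** A relation instead of a value: sums and products then carry existence and value of the
    derivative together. *)
Definition rD f (x l : R) := (diffquo f x --> l)%classic.

Lemma packed_le x s y : packed x s y -> x <= y.
Proof. by elim: s x => //= p s IH x /and3P[? ? /IH]; lra. Qed.

Lemma packed_cat x s y s' z : packed x s y -> packed y s' z -> packed x (s ++ s') z.
Proof.
elim: s x => /= [|p s IH] x.
  by case: s' => /= [|q s'] ? => [|/and3P[? -> ->]]; [lra|rewrite !andbT; lra].
by move=> /and3P[-> -> /IH h] /h ->.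
Qed.

Lemma packed_wr x s y z : y <= z -> packed x s y -> packed x s z.
Proof. by move=> yz; elim: s x => /= [x|p s IH x /and3P[-> ->] /IH]; [lra|]. Qed.

(** Half-open intervals keep touching neighbours disjoint, so measures and integrals add up
    exactly. *)
Fixpoint ucover s : set R :=
  if s is p :: s' then (`]p.1, p.2]%classic `|` ucover s')%classic else set0.

Lemma ucover_sub x s y : packed x s y -> (ucover s `<=` `]x, y])%classic.
Proof.
elim: s x => [x _ t []|p s IH x /= /and3P[xp pp sy] t].
have py := packed_le sy.
case=> [|/(IH _ sy)]; rewrite /= !in_itv/= => /andP[]; lra.
Qed.

Lemma measurable_ucover s : measurable (ucover s).
Proof. by elim: s => //= p s IH; apply: measurableU. Qed.

Lemma ucover_disj x s y p : packed x s y -> p.2 <= x ->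
  (`]p.1, p.2] `&` ucover s = set0)%classic.
Proof.
move=> h px; apply/seteqP; split=> // t [/=]; rewrite in_itv/= => /andP[_ t2].
by move=> /(ucover_sub h); rewrite /= in_itv/= => /andP[]; lra.
Qed.

Lemma mu_ucover x s y : packed x s y -> mu (ucover s) = (\sum_(p <- s) (p.2 - p.1))%:E.
Proof.
elim: s x => [|p s IH] x /=; first by rewrite big_nil measure0.
move=> /and3P[xp pp sy]; rewrite big_cons.
transitivity (mu `]p.1, p.2]%classic + mu (ucover s))%E.
  exact: (measureU mu (measurable_itv _) (measurable_ucover s) (ucover_disj sy (lexx p.2))).
rewrite (IH _ sy) lebesgue_measure_itv /= lte_fin EFinD EFinB; congr (_ + _)%E.
by case: ltgtP pp => // [->] _; rewrite subee.
Qed.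

(** Clearing the denominator includes [y = x], so the tag of a small interval may be one of its end
    points. *)
Lemma rD_approx f x l : rD f x l -> forall e : R, 0 < e -> exists2 d : R, 0 < d &
  forall y, I0pi y -> `|y - x| < d -> `|f y - f x - l * (y - x)| <= e * `|y - x|.
Proof.
move=> fl e e0.
have [d/= d0 h] := (@cvgrPdist_le _ _ _ _ _ _ _).1 fl e e0.
exists d => // y Iy yx.
have [->|neq] := eqVneq y x; first by rewrite !subrr mulr0 subrr normr0 mulr0.
have {}h : `|l - (f y - f x) / (y - x)| <= e by apply: h => //; rewrite /ball/= distrC.
have yx0 : y - x != 0 by rewrite subr_eq0.
have -> : f y - f x - l * (y - x) = - (l - (f y - f x) / (y - x)) * (y - x).
  by field.
by rewrite normrM normrN ler_wpM2r.
Qed.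

Lemma approx_rD f x l : (forall e : R, 0 < e -> exists2 d : R, 0 < d &
  forall y, I0pi y -> `|y - x| < d -> `|f y - f x - l * (y - x)| <= e * `|y - x|) ->
  rD f x l.
Proof.
move=> h; apply/cvgrPdist_le => e e0; have [d d0 {}h] := h e e0.
exists d => //= y; rewrite /ball/= distrC => yx neq Iy.
have := h y Iy yx.
have yx0 : y - x != 0 by rewrite subr_eq0.
have -> : f y - f x - l * (y - x) = - (l - (f y - f x) / (y - x)) * (y - x).
  by field.
by rewrite normrM normrN ler_pM2r // normr_gt0.
Qed.

Local Open Scope classical_set_scope.

Lemma ucover_cat s s' : ucover (s ++ s') = (ucover s `|` ucover s')%classic.
Proof. by elim: s => [|p s IH] /=; rewrite ?set0U // IH setUA. Qed.

Lemma null_cover (N : set R) (d : R) : 0 < d -> mu.-negligible N ->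
  exists U : set R, [/\ open U, N `<=` U & (mu U < d%:E)%E].
Proof.
move=> d0 [A [mA A0' NA]]; have A0 : mu A = 0%E := A0'.
have [|U [oU AU Ud]] := @lebesgue_regularity_outer _ A d mA _ d0.
  have fA : (mu A < +oo)%E by rewrite A0 ltry.
  exact: fA.
exists U; split=> //; first exact: subset_trans NA AU.
have mU : measurable U by exact: measurable_realfun.open_measurable.
have UE : (U `\` A) `|` A = U by rewrite setUC setDUK.
have : (mu ((U `\` A) `|` A) <= mu (U `\` A) + mu A)%E.
  by apply: measureU2 => //; exact: measurableD.
rewrite A0 adde0 UE => /le_lt_trans; exact.
Qed.

(* The null set where f' <= 0 fails is covered by a small open set U; Cousin's
   lemma then gives a partition of [0, x] whose intervals either lie in U, where
   absolute continuity bounds the increments, or are controlled by f'. *)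
Lemma rac_nonincr f : rac f ->
  {ae mu, forall x, I0pi x -> exists2 l, rD f x l & l <= 0} ->
  forall x, I0pi x -> f x <= f 0.
Proof.
move=> acf aef x Ix; apply/ler_addgt0Pr => e e0.
have p0 := pi_gt0 R.
move: Ix; rewrite /I0pi/= in_itv/= => /andP[x0 xp].
have e2 : 0 < e / 2 by lra.
have [d d0 acd] := acf _ e2.
have [U [oU NU Ud]] := null_cover d0 aef.
(* Half of [e] pays for the slopes over the whole of [0, pi], the other half for the increments
   inside [U]. *)
pose e' := e / 2 / pi.
have e'0 : 0 < e' by rewrite divr_gt0.
pose P y z := exists s, [/\ packed y s z, ucover s `<=` U &
  f z - f y <= e' * (z - y) + \sum_(p <- s) (f p.2 - f p.1)].
have [s [ps sU fs]] : P 0 x.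
  apply: cousin => // [y z t [s [ps sU fs]] [s' [ps' sU' fs']]|y /andP[y0 yx]].
    exists (s ++ s'); split; [exact: packed_cat ps ps'| |].
      by rewrite ucover_cat subUset.
    by rewrite big_cat/=; lra.
  have [Uy|nUy] := pselect (U y).
    have [d'/= d'0 dU] := (@nbhs_ballP R R y U).1 (open_nbhs_nbhs (conj oU Uy)).
    exists d' => // z t z0 zy yt tx zd td.
    exists [:: (z, t)]; split => /=.
    - by rewrite lexx (le_trans zy yt) lexx.
    - rewrite setU0 => w /=; rewrite in_itv/= => /andP[w1 w2].
      by apply: dU; rewrite /ball/= ltr_norml; lra.
    - by rewrite big_seq1/= lerDr mulr_ge0 ?(ltW e'0) ?subr_ge0 ?(le_trans zy yt).
  have [l fl l0] : exists2 l, rD f y l & l <= 0.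
    have : ~ ~ (I0pi y -> exists2 l, rD f y l & l <= 0) by move=> h; apply/nUy/NU.
    by move/contrapT; apply; rewrite /I0pi/= in_itv/=; lra.
  have [d' d'0 fd'] := rD_approx fl e'0.
  exists d' => // z t z0 zy yt tx zd td.
  exists [::]; split => //=; first by lra.
  rewrite big_nil addr0.
  have Iz : I0pi z by rewrite /I0pi/= in_itv/=; lra.
  have It : I0pi t by rewrite /I0pi/= in_itv/=; lra.
  (* The increment over [z, t] is split at the tag [y]; as [l <= 0], neither linear part increases
     it. *)
  have := fd' z Iz; have := fd' t It.
  rewrite (ger0_norm (_ : 0 <= t - y)) ?subr_ge0 // (ler0_norm (_ : z - y <= 0)) ?subr_le0 //.
  rewrite !ler_norml => /(_ _)/andP[|_]; first by lra.
  move=> h1 /(_ _)/andP[|h2 _]; first by lra.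
  have : l * (t - y) <= 0 by rewrite mulr_le0_ge0 // subr_ge0.
  have : 0 <= l * (z - y) by rewrite mulr_le0 // subr_le0.
  by lra.
have /acd : packed 0 s pi by exact: packed_wr ps.
have : (mu (ucover s) <= mu U)%E.
  apply: le_measure => //; rewrite ?inE; first exact: measurable_ucover.
  exact: measurable_realfun.open_measurable.
rewrite (mu_ucover ps) => /le_lt_trans/(_ Ud); rewrite lte_fin => sd /(_ sd) h.
have h2 : \sum_(p <- s) (f p.2 - f p.1) <= \sum_(p <- s) `|f p.2 - f p.1|.
  by apply: ler_sum => p _; exact: ler_norm.
have h3 : e' * x <= e / 2.
  by rewrite /e' -[leRHS](divfK (lt0r_neq0 p0)) ler_wpM2l // ltW.
by lra.
Qed.

(** A mean value inequality for an arbitrary derivative [D]: the inequality with slope [M + e']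
    composes over adjacent intervals and holds near every tag, so [cousin] applies to it
    directly. *)
Lemma rD_lip_le f (M : R) (D : R -> R) :
  (forall x, I0pi x -> rD f x (D x)) -> (forall x, I0pi x -> D x <= M) ->
  forall x y, 0 <= x -> x <= y -> y <= pi -> f y - f x <= M * (y - x).
Proof.
move=> hD DM x y x0 xy yp; apply/ler_addgt0Pr => e e0.
have p0 := pi_gt0 R.
pose e' := e / pi.
have e'0 : 0 < e' by rewrite divr_gt0.
suff h : f y - f x <= (M + e') * (y - x).
  have h3 : e' * (y - x) <= e.
    by rewrite /e' -[leRHS](divfK (lt0r_neq0 p0)) ler_wpM2l //; [exact: ltW|lra].
  by lra.
apply: (@cousin (fun x y => f y - f x <= (M + e') * (y - x))) => // [a b c h1 h2|w /andP[xw wy]].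
  by lra.
have Iw : I0pi w by rewrite /I0pi/= in_itv/=; lra.
have [d' d'0 fd'] := rD_approx (hD w Iw) e'0.
exists d' => // z t z0 zy yt tx zd td.
have Iz : I0pi z by rewrite /I0pi/= in_itv/=; lra.
have It : I0pi t by rewrite /I0pi/= in_itv/=; lra.
have := fd' z Iz; have := fd' t It.
rewrite (ger0_norm (_ : 0 <= t - w)) ?subr_ge0 // (ler0_norm (_ : z - w <= 0)) ?subr_le0 //.
rewrite !ler_norml => /(_ _)/andP[|_]; first by lra.
move=> h1 /(_ _)/andP[|h2 _]; first by lra.
have : D w * (t - w) <= M * (t - w) by rewrite ler_wpM2r ?subr_ge0 // DM.
have : D w * (w - z) <= M * (w - z) by rewrite ler_wpM2r ?subr_ge0 // DM.
by lra.
Qed.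

Lemma I0piE (x : R) : I0pi x = ((0 <= x) && (x <= pi)) :> Prop.
Proof. by rewrite /I0pi/= in_itv. Qed.

Lemma rD_lip f (M : R) (D : R -> R) :
  (forall x, I0pi x -> rD f x (D x)) -> (forall x, I0pi x -> `|D x| <= M) ->
  forall x y, 0 <= x -> x <= y -> y <= pi -> `|f y - f x| <= M * (y - x).
Proof.
move=> hD DM x y x0 xy yp; rewrite ler_norml; apply/andP; split; last first.
  by apply: (rD_lip_le hD) => // z Iz; apply: le_trans (DM z Iz); exact: ler_norm.
suff : (- f y) - (- f x) <= M * (y - x) by lra.
apply: (@rD_lip_le (fun z => - f z) M (fun z => - D z)) => // z Iz; last first.
  by apply: le_trans (DM z Iz); rewrite -normrN ler_norm.
apply: approx_rD => e e0; have [d d0 h] := rD_approx (hD z Iz) e0.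
exists d => // t It tz; have := h t It tz.
by rewrite -normrN; congr (`|_| <= _); ring.
Qed.

Definition rbounded f := exists2 M : R, 0 <= M & forall x, I0pi x -> `|f x| <= M.

Lemma loc_bounded f :
  (forall x, I0pi x -> exists2 d : R, 0 < d &
    exists M : R, forall y, I0pi y -> `|y - x| < d -> `|f y| <= M) ->
  rbounded f.
Proof.
move=> h; have p0 := pi_gt0 R.
suff [M hM] : exists M, forall t, 0 <= t <= pi -> `|f t| <= M.
  exists `|M|; rewrite ?normr_ge0 // => x; rewrite I0piE => /hM /le_trans; apply.
  exact: ler_norm.
apply: (@cousin (fun x y => exists M, forall t, x <= t <= y -> `|f t| <= M)).
- exact: ltW.
- move=> x y z [M1 h1] [M2 h2]; exists (Num.max M1 M2) => t /andP[xt tz].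
  rewrite le_max; have [ty|yt] := leP t y; first by rewrite h1 ?xt.
  by rewrite orbC h2 // ltW.
- move=> x xp; have [|d d0 [M hM]] := h x; first by rewrite I0piE.
  exists d => // y z y0 yx xz zp yd zd; exists M => t /andP[yt tz]; apply: hM.
    by rewrite I0piE; lra.
  by rewrite ltr_norml; lra.
Qed.

Lemma rac_unif f : rac f -> forall e : R, 0 < e -> exists2 d : R, 0 < d &
  forall x y, 0 <= x -> x <= y -> y <= pi -> y - x < d -> `|f y - f x| < e.
Proof.
move=> h e e0; have [d d0 hd] := h e e0; exists d => // x y x0 xy yp yx.
by have := hd [:: (x, y)]; rewrite /= !big_seq1/= x0 xy yp => /(_ isT yx).
Qed.

Lemma rac_bounded f : rac f -> rbounded f.
Proof.
move=> acf; apply: loc_bounded => x; rewrite I0piE => /andP[x0 xp].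
have [d d0 h] := rac_unif acf ltr01; exists d => //; exists (`|f x| + 1) => y.
rewrite I0piE => /andP[y0 yp] yx.
have : `|f y - f x| <= 1.
  have [xy|/ltW xy] := leP x y.
    by apply/ltW/h => //; move: yx; rewrite ger0_norm // subr_ge0.
  by rewrite distrC; apply/ltW/h => //; move: yx; rewrite distrC ger0_norm // subr_ge0.
have : `|f y| <= `|f y - f x| + `|f x| by rewrite -{1}[f y](subrK (f x)) ler_normD.
by lra.
Qed.

(** Differentiability bounds [f] near each point, with no bound on [D] assumed. This starts a
    bootstrap: P_+ and P_- are bounded, hence so are their derivatives by the equation. *)
Lemma rD_bounded f (D : R -> R) : (forall x, I0pi x -> rD f x (D x)) -> rbounded f.
Proof.
move=> hD; apply: loc_bounded => x Ix.
have [d d0 h] := rD_approx (hD x Ix) ltr01; exists (Num.min d 1); first by rewrite lt_min d0/=.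
exists (`|f x| + `|D x| + 1) => y Iy; rewrite lt_min => /andP[yd y1].
have {}h := h y Iy yd.
have e1 : f y = (f y - f x - D x * (y - x)) + f x + D x * (y - x) by ring.
have h1 : `|f y| <= `|f y - f x - D x * (y - x)| + `|f x| + `|D x * (y - x)|.
  rewrite {1}e1; apply: le_trans (ler_normD _ _) _; rewrite lerD2r; exact: ler_normD.
have h2 : `|D x * (y - x)| <= `|D x| by rewrite normrM ler_piMr // ltW.
by lra.
Qed.

Lemma rac_lip f (M : R) :
  (forall x y, 0 <= x -> x <= y -> y <= pi -> `|f y - f x| <= M * (y - x)) -> rac f.
Proof.
(* [N] is positive whatever the sign of [M], so one may divide by it. *)
move=> h e e0; pose N := `|M| + 1.
have N0 : 0 < N by rewrite ltr_wpDl.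
exists (e / N); first by rewrite divr_gt0.
move=> s ps sd.
suff hs : forall x, 0 <= x -> packed x s pi ->
    \sum_(p <- s) `|f p.2 - f p.1| <= N * \sum_(p <- s) (p.2 - p.1).
  apply: le_lt_trans (hs 0 _ ps) _ => //.
  by rewrite mulrC -ltr_pdivlMr.
elim: s {ps sd} => [|p s IH] x x0 /=; first by rewrite !big_nil mulr0.
move=> /and3P[xp pp ps]; rewrite !big_cons mulrDr lerD //.
  apply: le_trans (h _ _ _ _ _) _ => //; [lra|exact: packed_le ps|].
  by rewrite ler_wpM2r ?subr_ge0 // /N; apply: le_trans (ler_norm _) _; rewrite lerDl.
by apply: IH ps; lra.
Qed.

Lemma rac_rD f (D : R -> R) :
  (forall x, I0pi x -> rD f x (D x)) -> rbounded D -> rac f.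
Proof. by move=> hD [M M0 hM]; apply: (rac_lip (rD_lip hD hM)). Qed.

(** Common criterion behind the closure of absolute continuity under sums, products and exp(- f). *)
Lemma rac_dom f g h (M : R) : 0 <= M -> rac f -> rac g ->
  (forall x y, I0pi x -> I0pi y ->
     `|h y - h x| <= M * (`|f y - f x| + `|g y - g x|)) -> rac h.
Proof.
(* Each of the two sums gets [e / N], so that (M + 1) (e / N + e / N) = e; [M + 1] rather than [M]
   keeps the inequality strict when [M = 0]. *)
move=> M0 acf acg hle e e0; pose N := 2 * (M + 1).
have N0 : 0 < N by rewrite mulr_gt0 // ltr_wpDl.
have eN : 0 < e / N by rewrite divr_gt0.
have [d1 d10 h1] := acf _ eN.
have [d2 d20 h2] := acg _ eN.
exists (Num.min d1 d2); first by rewrite lt_min d10.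
move=> s ps; rewrite lt_min => /andP[/(h1 s ps) {}h1 /(h2 s ps) {}h2].
have hs : forall x, 0 <= x -> packed x s pi -> \sum_(p <- s) `|h p.2 - h p.1| <=
   M * (\sum_(p <- s) `|f p.2 - f p.1| + \sum_(p <- s) `|g p.2 - g p.1|).
  elim: (s) => [|p s' IH] x x0 /=; first by rewrite !big_nil addr0 mulr0.
  move=> /and3P[xp pp pss]; have pp' := packed_le pss; rewrite !big_cons addrACA mulrDr lerD //.
    by apply: hle; rewrite I0piE; lra.
  by apply: IH pss; lra.
apply: le_lt_trans (hs 0 _ ps) _ => //.
have : M * (\sum_(p <- s) `|f p.2 - f p.1| + \sum_(p <- s) `|g p.2 - g p.1|) <=
   (M + 1) * (\sum_(p <- s) `|f p.2 - f p.1| + \sum_(p <- s) `|g p.2 - g p.1|).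
  by rewrite ler_wpM2r ?lerDl // addr_ge0 // sumr_ge0.
move=> /le_lt_trans; apply.
have -> : e = (M + 1) * (e / N + e / N) by rewrite /N; field; lra.
by rewrite ltr_pM2l; lra.
Qed.

Lemma rac_cst (c : R) : rac (fun _ => c).
Proof. by apply: (@rac_lip _ 0) => *; rewrite subrr normr0 mul0r. Qed.

Lemma rac_ext f g : (forall x, I0pi x -> f x = g x) -> rac f -> rac g.
Proof.
move=> fg acf; apply: (@rac_dom f f g 1) => // x y Ix Iy.
by rewrite mul1r -!fg // lerDl.
Qed.

Lemma rac_add f g : rac f -> rac g -> rac (fun x => f x + g x).
Proof.
move=> af ag; apply: (@rac_dom f g _ 1) => // x y _ _; rewrite mul1r opprD addrACA.
exact: ler_normD.
Qed.

Lemma rac_opp f : rac f -> rac (fun x => - f x).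
Proof.
move=> af; apply: (@rac_dom f f _ 1) => // x y _ _; rewrite mul1r -opprD normrN.
by rewrite lerDl.
Qed.

Lemma rac_mul f g : rac f -> rac g -> rac (fun x => f x * g x).
Proof.
move=> af ag; have [M M0 hM] := rac_bounded af; have [N N0 hN] := rac_bounded ag.
apply: (@rac_dom f g _ (M + N)) => //; first by rewrite addr_ge0.
move=> x y Ix Iy.
have -> : f y * g y - f x * g x = (f y - f x) * g y + f x * (g y - g x) by ring.
apply: le_trans (ler_normD _ _) _; rewrite !normrM mulrDr lerD //.
  by rewrite mulrC ler_wpM2r // (le_trans (hN _ Iy)) // lerDr.
by rewrite ler_wpM2r // (le_trans (hM _ Ix)) // lerDl.
Qed.

(** exp(- t) is 1-Lipschitz for t >= 0. This is for the integrating factor in Gronwall's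
    inequality. *)
Lemma rac_expN f : (forall x, I0pi x -> 0 <= f x) -> rac f -> rac (fun x => expR (- f x)).
Proof.
move=> f0 af; apply: (@rac_dom f f _ 1) => // x y Ix Iy; rewrite mul1r.
suff key (a b : R) : 0 <= a -> a <= b -> `|expR (- b) - expR (- a)| <= `|b - a|.
  have [fxy|/ltW fxy] := leP (f x) (f y).
    by apply: le_trans (key _ _ (f0 _ Ix) fxy) _; rewrite lerDl.
  by rewrite distrC; apply: le_trans (key _ _ (f0 _ Iy) fxy) _; rewrite distrC lerDl.
move=> a0 ab; rewrite distrC ger0_norm ?subr_ge0 ?ler_expR ?lerN2 //.
rewrite ger0_norm ?subr_ge0 //.
have -> : - b = - a + (a - b) by ring.
rewrite expRD -{1}[expR (- a)]mulr1 -mulrBr.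
have h1 : expR (- a) <= 1 by rewrite -expR0 ler_expR oppr_le0.
have h2 := expR_ge1Dx (a - b).
have h3 : expR (a - b) <= 1 by rewrite -expR0 ler_expR subr_le0.
apply: le_trans (_ : 1 * (1 - expR (a - b)) <= _).
  by rewrite ler_wpM2r // subr_ge0.
by lra.
Qed.

End AbsoluteContinuity.

(** * Derivatives within [0, pi] and Gronwall's inequality with an integrable coefficient *)

Section Gronwall.
Context {R : realType}.
Implicit Types (f g : R -> R) (s : seq (R * R)).
Local Notation mu := (@lebesgue_measure R).
Local Open Scope classical_set_scope.

Lemma ae_imp (P Q : R -> Prop) : (forall x, P x -> Q x) ->
  {ae mu, forall x, P x} -> {ae mu, forall x, Q x}.
Proof. by move=> PQ; apply: filterS; first exact: (ae_filter_ringOfSetsType mu). Qed.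

Lemma ae_imp2 (P Q S : R -> Prop) : (forall x, P x -> Q x -> S x) ->
  {ae mu, forall x, P x} -> {ae mu, forall x, Q x} -> {ae mu, forall x, S x}.
Proof. by move=> PQ; apply: filterS2; first exact: (ae_filter_ringOfSetsType mu). Qed.

(** The two end points form a null set. This carries the pencil equation, given on the open
    interval, to [0, pi]. *)
Lemma ae_oo_cc (P : R -> Prop) : {ae mu, forall x, `]0%R, pi[%classic x -> P x} ->
  {ae mu, forall x, I0pi x -> P x}.
Proof.
have ae_neq (a : R) : {ae mu, forall x, x <> a}.
  exists [set a]; split; [exact: measurable_set1|exact: lebesgue_measure_set1|].
  by move=> x /= /contrapT.
have h1 : {ae mu, forall x : R, x <> 0 /\ x <> pi}.
  by apply: ae_imp2 (ae_neq 0) (ae_neq pi) => x.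
apply: ae_imp2 h1 => x [x0 xp] h; rewrite I0piE => /andP[x0' xp']; apply: h.
by rewrite /= in_itv/= !lt_neqAle x0' xp' !andbT eq_sym; apply/andP; split; apply/eqP.
Qed.

Lemma is_derive_rD f (x l : R) : is_derive x 1 f l -> rD f x l.
Proof.
move=> [df fl]; apply: approx_rD => e e0.
have h : (h^-1 *: (f (h *: 1 + x) - f x)) @[h --> (0 : R)^'] --> l.
  by rewrite -fl; exact: df.
have [d/= d0 {}h] := (@cvgrPdist_le _ _ _ _ _ _ _).1 h e e0.
exists d => // y Iy yx.
have [->|neq] := eqVneq y x; first by rewrite !subrr mulr0 subrr normr0 mulr0.
have yx0 : y - x != 0 by rewrite subr_eq0.
have := h (y - x); rewrite /ball/= sub0r normrN => /(_ yx yx0).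
rewrite /GRing.scale/= mulr1 subrK => {}h.
have -> : f y - f x - l * (y - x) = - (l - (y - x)^-1 * (f y - f x)) * (y - x).
  by field.
by rewrite normrM normrN ler_wpM2r.
Qed.

Lemma rD_add f g (x l k : R) : rD f x l -> rD g x k -> rD (fun y => f y + g y) x (l + k).
Proof.
move=> fl gk; rewrite /rD /diffquo.
rewrite (_ : (fun y => _) = (fun y => (f y - f x) / (y - x) + (g y - g x) / (y - x))).
  exact: cvgD.
by apply/funext => y; ring.
Qed.

Lemma rD_continuous f (x l : R) : rD f x l -> f y @[y --> within I0pi x^'] --> f x.
Proof.
move=> fl.
have yx : (y - x) @[y --> within I0pi x^'] --> (0 : R).
  apply/cvgrPdist_le => e e0; exists e => //= y; rewrite /ball/= => yx _ _.
  by rewrite sub0r opprB ltW.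
pose h y := (f y - f x) / (y - x) * (y - x) + f x.
have : h y @[y --> within I0pi x^'] --> l * 0 + f x.
  apply: cvgD; last exact: cvg_cst.
  exact: cvgM.
have -> : h = f.
  apply/funext => y; rewrite /h.
  have [->|neq] := eqVneq y x; first by rewrite !subrr mulr0 add0r.
  by rewrite divfK ?subr_eq0 // subrK.
by rewrite mulr0 add0r.
Qed.

Lemma rD_mul f g (x l k : R) : rD f x l -> rD g x k ->
  rD (fun y => f y * g y) x (l * g x + f x * k).
Proof.
move=> fl gk; rewrite /rD /diffquo.
rewrite (_ : (fun y => _) = (fun y => (f y - f x) / (y - x) * g x + f y * ((g y - g x) / (y - x)))).
  apply: cvgD; apply: cvgM => //; [exact: cvg_cst|exact: rD_continuous fl].
by apply/funext => y; ring.
Qed.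

Lemma rD_cst (c x : R) : rD (fun _ => c) x 0.
Proof.
rewrite /rD /diffquo (_ : (fun y => _) = (fun _ => 0)); first exact: cvg_cst.
by apply/funext => y; rewrite subrr mul0r.
Qed.

Lemma rD_opp f (x l : R) : rD f x l -> rD (fun y => - f y) x (- l).
Proof.
move=> fl; rewrite /rD /diffquo.
rewrite (_ : (fun y => _) = (fun y => - ((f y - f x) / (y - x)))); first exact: cvgN.
by apply/funext => y; ring.
Qed.

Section primitive.
Context (g : R -> R) (g0 : forall x, 0 <= g x)
  (ig : mu.-integrable setT (EFin \o g)).
Let G (x : R) : R := (\int[mu]_(t in `[0%R, x]) g t)%R.

Let igS (A : set R) : measurable A -> mu.-integrable A (EFin \o g).
Proof. by move=> mA; apply: integrableS ig. Qed.

Lemma primitive_ge0 x : 0 <= G x.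
Proof. exact: Rintegral_ge0. Qed.

Lemma primitive_sub (x y : R) : 0 <= x -> x <= y ->
  G y - G x = (\int[mu]_(t in `]x, y]) g t)%R.
Proof. by move=> x0 xy; rewrite Rintegral_itvB ?bnd_simp //; exact: igS. Qed.

Lemma primitive_le x y : 0 <= x -> x <= y -> G x <= G y.
Proof.
by move=> x0 xy; rewrite -subr_ge0 primitive_sub //; exact: Rintegral_ge0.
Qed.

Lemma primitive_ucover s x y : 0 <= x -> packed x s y ->
  \sum_(p <- s) `|G p.2 - G p.1| = (\int[mu]_(t in ucover s) g t)%R.
Proof.
elim: s x => [|p s IH] x x0 /=; first by rewrite big_nil Rintegral_set0.
move=> /and3P[xp pp ps]; rewrite big_cons.
have p10 : 0 <= p.1 by lra.
rewrite (IH p.2) //; last by lra.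
rewrite Rintegral_setU //.
- by rewrite ger0_norm ?subr_ge0 ?primitive_le // primitive_sub.
- exact: measurable_ucover.
- by apply: igS; apply: measurableU => //; exact: measurable_ucover.
- by apply/disj_setPS; rewrite (ucover_disj ps).
Qed.

(** As [g >= 0], the sum of increments is one integral over [ucover s], whose measure is the total
    length; absolute continuity of the integral concludes. *)
Lemma rac_primitive : rac G.
Proof.
move=> e e0; have [d [d0 h]] := integral_normr_continuous ig e0.
exists d => // s ps sd; rewrite (primitive_ucover _ ps) //.
have -> : (\int[mu]_(t in ucover s) g t = \int[mu]_(t in ucover s) `|g t|)%R.
  by apply: eq_Rintegral => t _; rewrite ger0_norm.
apply: h; first exact: measurable_ucover.
by have := mu_ucover ps => /= ->; rewrite lte_fin.
Qed.

Lemma rD_primitive : {ae mu, forall x, I0pi x -> is_derive x 1 G (g x)}.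
Proof.
have := @FTC1 R g (BLeft 0) (fun y => igS (measurable_itv _))
  (open_integrable_locally openT ig).
move=> h; apply: ae_oo_cc; move: h; apply: ae_imp => x h /=; rewrite in_itv/= => /andP[x0 xp].
have [|dG <-] := h _; first by rewrite /= lte_fin.
by rewrite derive1E; exact: derivableP.
Qed.

(** The product F exp(- G) is absolutely continuous with derivative (F' - g F) exp(- G) <= 0 almost
    everywhere, so [rac_nonincr] applies to it. *)
Lemma gronwall F : rac F -> 0 <= F 0 ->
  {ae mu, forall x, I0pi x -> exists2 l, rD F x l & l <= g x * F x} ->
  forall x, I0pi x -> F x <= F 0 * expR (G pi).
Proof.
move=> aF F0 aeF x Ix.
pose H x := F x * expR (- G x).
have aH : rac H.
  by apply: rac_mul => //; apply: rac_expN rac_primitive => y _; exact: primitive_ge0.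
have /(_ x Ix) : forall x, I0pi x -> H x <= H 0.
  apply: rac_nonincr aH _; have := rD_primitive; move: aeF; apply: ae_imp2.
  move=> y h1 h2 Iy; have [l Fl lg] := h1 Iy; have dG := h2 Iy.
  have eG : is_derive y 1 (fun z => expR (- G z)) (expR (- G y) * - g y).
    have -> : (fun z => expR (- G z)) = expR \o (- G) by [].
    by apply: is_derive1_comp.
  exists (l * expR (- G y) + F y * (expR (- G y) * - g y)).
    by apply: rD_mul => //; exact: is_derive_rD.
  have -> : l * expR (- G y) + F y * (expR (- G y) * - g y) = (l - g y * F y) * expR (- G y).
    by ring.
  by rewrite mulr_le0_ge0 ?expR_ge0 // subr_le0.
move: Ix; rewrite I0piE => /andP[x0 xp].
(* This sign and the monotonicity of [G] bound [G x - G 0] by [G pi]. *)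
have G00 : 0 <= G 0 by exact: primitive_ge0.
rewrite /H => h.
have h1 : F x <= F 0 * expR (- G 0) * expR (G x).
  by rewrite -ler_pdivrMr ?expR_gt0 // -expRN.
apply: le_trans h1 _; rewrite -mulrA ler_wpM2l // -expRD ler_expR.
by have := primitive_le x0 xp; lra.
Qed.

End primitive.
End Gronwall.

(** * Complex-valued functions *)

Section ComplexCalculus.
Context {R : realType}.
Implicit Types (f g : R -> R[i]) (z w : R[i]).
Local Notation mu := (@lebesgue_measure R).
Local Notation Re := complex.Re.
Local Notation Im := complex.Im.

Lemma normc_sqr z : normc z ^+ 2 = Re z ^+ 2 + Im z ^+ 2.
Proof. by case: z => a b; rewrite /normc sqr_sqrtr // addr_ge0 ?sqr_ge0. Qed.

Lemma normc_ge0 z : 0 <= normc z.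
Proof. by case: z => a b; rewrite /normc sqrtr_ge0. Qed.

Lemma normc_Re z : `|Re z| <= normc z.
Proof.
rewrite -(ler_sqr (normr_ge0 _) (normc_ge0 z)) normc_sqr real_normK ?num_real //.
by rewrite lerDl sqr_ge0.
Qed.

Lemma normc_Im z : `|Im z| <= normc z.
Proof.
rewrite -(ler_sqr (normr_ge0 _) (normc_ge0 z)) normc_sqr real_normK ?num_real //.
by rewrite lerDr sqr_ge0.
Qed.

Lemma normc_le z : normc z <= `|Re z| + `|Im z|.
Proof.
have h : 0 <= `|Re z| + `|Im z| by rewrite addr_ge0.
rewrite -(ler_sqr (normc_ge0 z) h) normc_sqr sqrrD !real_normK ?num_real //.
by rewrite lerD2r lerDl mulrn_wge0 // mulr_ge0.
Qed.

Lemma normc_real (a : R) : normc a%:C = `|a|.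
Proof. by rewrite /normc /= expr0n addr0 sqrtr_sqr. Qed.

Lemma Re_mul z w : Re (z * w) = Re z * Re w - Im z * Im w.
Proof. by case: z w => a b [c d]. Qed.

Lemma Im_mul z w : Im (z * w) = Re z * Im w + Im z * Re w.
Proof. by case: z w => a b [c d]. Qed.

Lemma Re_add z w : Re (z + w) = Re z + Re w.
Proof. by case: z w => a b [c d]. Qed.

Lemma Im_add z w : Im (z + w) = Im z + Im w.
Proof. by case: z w => a b [c d]. Qed.

(** The left side is the real part of z times the conjugate of w. *)
Lemma dot_le z w : Re z * Re w + Im z * Im w <= normc z * normc w.
Proof.
apply: le_trans (ler_norm _) _.
have -> : normc z * normc w = normc (z * (Re w -i* Im w)).
  rewrite normcM; congr (_ * _); case: w => c d; rewrite /normc /=.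
  by rewrite sqrrN.
apply: le_trans (normc_Re _); rewrite Re_mul /= mulrN opprK.
exact: lexx.
Qed.

Definition cD f x (l : R[i]) := rD (fun t => Re (f t)) x (Re l) /\ rD (fun t => Im (f t)) x (Im l).

Definition cac f := rac (fun t => Re (f t)) /\ rac (fun t => Im (f t)).

(** The calculus of the proof: formulas for [f'] are needed almost everywhere only, and absolute
    continuity is kept alongside so that they can be integrated. *)
Definition reg f f' := cac f /\ {ae mu, forall x, I0pi x -> cD f x (f' x)}.

Lemma cderivable_cD f x : cderivable f x -> cD f x (cderive f x).
Proof. by case. Qed.

Lemma cD_add f g x l k : cD f x l -> cD g x k -> cD (fun y => f y + g y) x (l + k).
Proof.
move=> [f1 f2] [g1 g2]; split.
  rewrite Re_add (_ : (fun t => _) = (fun t => Re (f t) + Re (g t))); first exact: rD_add.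
  by apply/funext => y; rewrite Re_add.
rewrite Im_add (_ : (fun t => _) = (fun t => Im (f t) + Im (g t))); first exact: rD_add.
by apply/funext => y; rewrite Im_add.
Qed.

Lemma cac_add f g : cac f -> cac g -> cac (fun y => f y + g y).
Proof.
move=> [f1 f2] [g1 g2]; split.
  by apply: rac_ext (rac_add f1 g1) => y; rewrite Re_add.
by apply: rac_ext (rac_add f2 g2) => y; rewrite Im_add.
Qed.

Lemma cD_mul f g x l k : cD f x l -> cD g x k ->
  cD (fun y => f y * g y) x (l * g x + f x * k).
Proof.
move=> [f1 f2] [g1 g2]; split.
  rewrite (_ : (fun t => _) = (fun t => Re (f t) * Re (g t) + - (Im (f t) * Im (g t)))).
    rewrite (_ : Re _ = (Re l * Re (g x) + Re (f x) * Re k) + - (Im l * Im (g x) + Im (f x) * Im k)).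
      by apply: rD_add; [exact: rD_mul|apply: rD_opp; exact: rD_mul].
    by rewrite Re_add !Re_mul; ring.
  by apply/funext => y; rewrite Re_mul.
rewrite (_ : (fun t => _) = (fun t => Re (f t) * Im (g t) + Im (f t) * Re (g t))).
  rewrite (_ : Im _ = (Re l * Im (g x) + Re (f x) * Im k) + (Im l * Re (g x) + Im (f x) * Re k)).
    by apply: rD_add; exact: rD_mul.
  by rewrite Im_add !Im_mul; ring.
by apply/funext => y; rewrite Im_mul.
Qed.

Lemma cac_mul f g : cac f -> cac g -> cac (fun y => f y * g y).
Proof.
move=> [f1 f2] [g1 g2]; split.
  by apply: rac_ext (rac_add (rac_mul f1 g1) (rac_opp (rac_mul f2 g2))) => y; rewrite Re_mul.
by apply: rac_ext (rac_add (rac_mul f1 g2) (rac_mul f2 g1)) => y; rewrite Im_mul.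
Qed.

Lemma cD_cst c x : cD (fun _ => c) x 0.
Proof. by split; exact: rD_cst. Qed.

Lemma cac_cst c : cac (fun _ => c).
Proof. by split; exact: rac_cst. Qed.

Lemma reg_add f f' g g' : reg f f' -> reg g g' ->
  reg (fun y => f y + g y) (fun y => f' y + g' y).
Proof.
move=> [af df] [ag dg]; split; first exact: cac_add.
by apply: ae_imp2 df dg => x h1 h2 Ix; apply: cD_add; [exact: h1|exact: h2].
Qed.

Lemma reg_mul f f' g g' : reg f f' -> reg g g' ->
  reg (fun y => f y * g y) (fun y => f' y * g y + f y * g' y).
Proof.
move=> [af df] [ag dg]; split; first exact: cac_mul.
by apply: ae_imp2 df dg => x h1 h2 Ix; apply: cD_mul; [exact: h1|exact: h2].
Qed.

Lemma reg_cst c : reg (fun _ => c) (fun _ => 0).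
Proof. by split; [exact: cac_cst|apply: aeW => x _; exact: cD_cst]. Qed.

Lemma reg_sum (I : Type) (r : seq I) (F F' : I -> R -> R[i]) :
  (forall i, reg (F i) (F' i)) ->
  reg (fun x => \sum_(i <- r) F i x) (fun x => \sum_(i <- r) F' i x).
Proof.
move=> h; elim: r => [|i r IH].
  rewrite (_ : (fun x => _) = fun _ => 0); last by apply/funext => x; rewrite big_nil.
  rewrite (_ : (fun x => _) = fun _ => 0); last by apply/funext => x; rewrite big_nil.
  exact: reg_cst.
rewrite (_ : (fun x => _) = fun x => F i x + \sum_(i <- r) F i x); last first.
  by apply/funext => x; rewrite big_cons.
rewrite [X in reg _ X](_ : _ = fun x => F' i x + \sum_(i <- r) F' i x); last first.
  by apply/funext => x; rewrite big_cons.
exact: reg_add.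
Qed.

Lemma cac_bounded f : cac f -> exists2 M : R, 0 <= M & forall x, I0pi x -> normc (f x) <= M.
Proof.
move=> [/rac_bounded[M M0 hM] /rac_bounded[N N0 hN]]; exists (M + N); rewrite ?addr_ge0 // => x Ix.
by apply: le_trans (normc_le _) _; rewrite lerD ?hM ?hN.
Qed.

Lemma cD_bounded f f' : (forall x, I0pi x -> cD f x (f' x)) ->
  exists2 M : R, 0 <= M & forall x, I0pi x -> normc (f x) <= M.
Proof.
move=> h; have [x /h[]//|M M0 hM] := @rD_bounded R (fun t => Re (f t)) (fun t => Re (f' t)).
have [x /h[]//|N N0 hN] := @rD_bounded R (fun t => Im (f t)) (fun t => Im (f' t)).
exists (M + N); rewrite ?addr_ge0 // => x Ix.
by apply: le_trans (normc_le _) _; rewrite lerD ?hM ?hN.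
Qed.

Lemma reg_cD f f' : (forall x, I0pi x -> cD f x (f' x)) ->
  (exists M : R, forall x, I0pi x -> normc (f' x) <= M) -> reg f f'.
Proof.
move=> h [M hM]; split; last by apply: aeW.
have M0 : 0 <= M.
  by apply: le_trans (hM 0 _); rewrite ?normc_ge0 // I0piE lexx pi_ge0.
split.
  apply: (@rac_rD _ _ (fun t => Re (f' t))) => [x /h[]//|]; exists M => // x /hM.
  exact: le_trans (normc_Re _).
apply: (@rac_rD _ _ (fun t => Im (f' t))) => [x /h[]//|]; exists M => // x /hM.
exact: le_trans (normc_Im _).
Qed.

Lemma is_derive_lin (a x : R) : is_derive x 1 (fun t => a * t) a.
Proof.
have -> : (fun t => a * t) = a *: (id : R -> R) by [].
by apply: is_derive_eq; rewrite /GRing.scale/= mulr1.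
Qed.

Lemma cD_cexp c x : cD (fun t => cexp (c * t%:C)) x (c * cexp (c * x%:C)).
Proof.
have e1 : rD (fun t => expR (Re c * t)) x (expR (Re c * x) * Re c).
  apply: is_derive_rD; apply: (@is_derive1_comp _ expR); exact: is_derive_lin.
have e2 : rD (fun t => cos (Im c * t)) x (- sin (Im c * x) * Im c).
  apply: is_derive_rD; apply: (@is_derive1_comp _ cos); exact: is_derive_lin.
have e3 : rD (fun t => sin (Im c * t)) x (cos (Im c * x) * Im c).
  apply: is_derive_rD; apply: (@is_derive1_comp _ sin); exact: is_derive_lin.
have E y : cexp (c * y%:C) = (expR (Re c * y) * cos (Im c * y)) +i* (expR (Re c * y) * sin (Im c * y)).
  by rewrite /cexp Re_mul Im_mul /= !mulr0 subr0 add0r.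
split.
  rewrite (_ : (fun t => _) = (fun t => expR (Re c * t) * cos (Im c * t))); last first.
    by apply/funext => y; rewrite E.
  rewrite [X in rD _ _ X](_ : _ = expR (Re c * x) * Re c * cos (Im c * x) + expR (Re c * x) * (- sin (Im c * x) * Im c)).
    exact: rD_mul.
  by rewrite E Re_mul /=; ring.
rewrite (_ : (fun t => _) = (fun t => expR (Re c * t) * sin (Im c * t))); last first.
  by apply/funext => y; rewrite E.
rewrite [X in rD _ _ X](_ : _ = expR (Re c * x) * Re c * sin (Im c * x) + expR (Re c * x) * (cos (Im c * x) * Im c)).
  exact: rD_mul.
by rewrite E Im_mul /=; ring.
Qed.

Lemma reg_cexp c : reg (fun t => cexp (c * t%:C)) (fun x => c * cexp (c * x%:C)).
Proof.
apply: reg_cD => [x _|]; first exact: cD_cexp.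
have [x _|M M0 hM] := @cD_bounded (fun t => cexp (c * t%:C)) (fun x => c * cexp (c * x%:C)).
  exact: cD_cexp.
by exists (normc c * M) => x Ix; rewrite normcM ler_wpM2l ?normc_ge0 // hM.
Qed.

Lemma cexpD z w : cexp (z + w) = cexp z * cexp w.
Proof.
case: z w => a b [c d]; rewrite /cexp /= expRD cosD sinD.
by apply/eqP; rewrite eq_complex /=; apply/andP; split; apply/eqP; ring.
Qed.

Lemma cexp0 : cexp 0 = 1 :> R[i].
Proof. by rewrite /cexp /= expR0 cos0 sin0 mulr1 mulr0. Qed.

Lemma normc_cexp z : normc (cexp z) = expR (Re z).
Proof.
apply/eqP; rewrite -(@eqrXn2 _ 2) ?nnegrE ?normc_ge0 ?expR_ge0 // normc_sqr /=.
by rewrite !exprMn -mulrDr cos2Dsin2 mulr1.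
Qed.

Lemma packed_nth (x y : R) (s : seq (R * R)) i : packed x s y -> (i < size s)%N ->
  [/\ x <= (nth (0, 0) s i).1, (nth (0, 0) s i).1 <= (nth (0, 0) s i).2 & (nth (0, 0) s i).2 <= y].
Proof.
elim: s x i => //= p s IH x [|i] /and3P[xp pp ps] /=.
  by move=> _; split=> //; exact: packed_le ps.
by rewrite ltnS => /(IH _ _ ps)[h1 h2 h3]; split=> //; lra.
Qed.

Lemma packed_nth_le (x y : R) (s : seq (R * R)) i j : packed x s y -> (i < j)%N ->
  (j < size s)%N -> (nth (0, 0) s i).2 <= (nth (0, 0) s j).1.
Proof.
elim: s x i j => //= p s IH x [|i] [|j] // /and3P[xp pp ps] /=.
  by move=> _; rewrite ltnS => /(packed_nth ps)[].
by rewrite !ltnS; exact: IH ps.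
Qed.

(** An ordered list is a family indexed by positions. Its intervals may touch, which the definition
    allows because it asks for disjoint open intervals. *)
Lemma abs_continuous_cac f : abs_continuous f -> cac f.
Proof.
move=> af.
suff h (e : R) : 0 < e -> exists2 d : R, 0 < d &
    forall s, packed 0 s pi -> \sum_(p <- s) (p.2 - p.1) < d ->
    \sum_(p <- s) normc (f p.2 - f p.1) < e.
  split=> e /h[d d0 hd]; exists d => // s ps /(hd _ ps); apply: le_lt_trans.
    apply: ler_sum => p _; apply: le_trans (normc_Re _).
    by case: (f p.2) (f p.1) => ? ? [].
  apply: ler_sum => p _; apply: le_trans (normc_Im _).
  by case: (f p.2) (f p.1) => ? ? [].
move=> e0; have [d d0 hd] := af e e0; exists d => // s ps.
rewrite !(big_nth (0, 0)) !big_mkord => sd.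
apply: (hd _ (fun i : 'I_(size s) => (nth (0, 0) s i).1) (fun i => (nth (0, 0) s i).2)) => // [k|].
  by have [] := packed_nth ps (ltn_ord k).
suff tI (i j : 'I_(size s)) t : (i < j)%N -> t < (nth (0, 0) s i).2 -> (nth (0, 0) s j).1 < t -> False.
  move=> i j _ _ [t [/=]]; rewrite !in_itv/= => /andP[i1 i2] /andP[j1 j2].
  apply: val_inj => /=; case: (ltngtP i j) => // ij.
    by case: (tI _ _ _ ij i2 j1).
  by case: (tI _ _ _ ij j2 i1).
by move=> ij t1 t2; have := packed_nth_le ps ij (ltn_ord j); lra.
Qed.

End ComplexCalculus.

(** * Matrix functions *)

Section Domination.
Context {R : realType}.
Local Notation mu := (@lebesgue_measure R).
Local Open Scope classical_set_scope.

(** [f] is known only up to a null set and may fail to be Borel measurable, hence the majorant; it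
    is integrable on the whole line, as the primitive in [gronwall] requires. *)
Definition dominated (f : R -> R) := exists g : R -> R,
  [/\ forall x, 0 <= g x, mu.-integrable setT (EFin \o g) &
      {ae mu, forall x, I0pi x -> f x <= g x}].

Lemma measurable_I0pi : measurable (@I0pi R).
Proof. exact: measurable_itv. Qed.

Lemma restrict_integrable (g : R -> R) : mu.-integrable (@I0pi R) (EFin \o g) ->
  mu.-integrable setT (EFin \o (g \_ (@I0pi R))).
Proof.
move=> ig; rewrite -restrict_EFin; apply/integrable_restrict => //=; rewrite ?setTI //.
exact: measurable_I0pi.
Qed.

Lemma restrict_I0pi (g : R -> R) x : I0pi x -> (g \_ (@I0pi R)) x = g x.
Proof. by move=> Ix; rewrite patchE mem_set. Qed.

Lemma L1_dominated (f : R -> R[i]) : L1 f -> dominated (fun x => normc (f x)).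
Proof.
move=> [g [iR iI fg]].
pose h x := `|complex.Re (g x)| + `|complex.Im (g x)|.
exists (h \_ (@I0pi R)); split.
- by move=> x; rewrite patchE; case: ifP => // _; rewrite /h addr_ge0.
- apply: restrict_integrable.
  rewrite (_ : EFin \o h = (abse \o (fun x => (complex.Re (g x))%:E)) \+
     (abse \o (fun x => (complex.Im (g x))%:E)))%E //.
  by apply: integrableD; [exact: measurable_I0pi|exact: integrable_abse|exact: integrable_abse].
- apply: ae_imp fg => x h1 Ix; rewrite restrict_I0pi // (h1 Ix); exact: normc_le.
Qed.

Lemma dominated_cst (c : R) : 0 <= c -> dominated (fun _ => c).
Proof.
move=> c0; exists ((fun _ => c) \_ (@I0pi R)); split.
- by move=> x; rewrite patchE; case: ifP.
- apply: restrict_integrable.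
  apply: continuous_compact_integrable; first exact: segment_compact.
  by apply: continuous_subspaceT => x; exact: cvg_cst.
- by apply: aeW => x Ix; rewrite restrict_I0pi.
Qed.

Lemma dominated_add f g : dominated f -> dominated g -> dominated (fun x => f x + g x).
Proof.
move=> [f' [f0 fi fl]] [g' [g0 gi gl]]; exists (fun x => f' x + g' x); split.
- by move=> x; rewrite addr_ge0.
- rewrite (_ : EFin \o _ = (EFin \o f') \+ (EFin \o g'))%E //; exact: integrableD.
- by apply: ae_imp2 fl gl => x h1 h2 Ix; rewrite lerD ?h1 ?h2.
Qed.

Lemma dominated_scale (c : R) f : 0 <= c -> dominated f -> dominated (fun x => c * f x).
Proof.
move=> c0 [f' [f0 fi fl]]; exists (fun x => c * f' x); split.
- by move=> x; rewrite mulr_ge0.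
- rewrite (_ : EFin \o _ = (fun x => c%:E * (EFin \o f') x))%E //; exact: integrableZl.
- by apply: ae_imp fl => x h1 Ix; rewrite ler_wpM2l ?h1.
Qed.

Lemma dominated_sum (I : Type) (r : seq I) (F : I -> R -> R) :
  (forall i, dominated (F i)) -> dominated (fun x => \sum_(i <- r) F i x).
Proof.
move=> h; elim: r => [|i r IH].
  rewrite (_ : (fun x => _) = fun _ => 0); first exact: dominated_cst.
  by apply/funext => x; rewrite big_nil.
rewrite (_ : (fun x => _) = fun x => F i x + \sum_(i <- r) F i x); first exact: dominated_add.
by apply/funext => x; rewrite big_cons.
Qed.

(** [K] is chosen before [F]: it depends on the integral of the majorant alone, which makes the
    final constants independent of rho. *)
Lemma gronwall_dominated (f : R -> R) : dominated f -> exists2 K : R, 0 <= K &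
  forall F : R -> R, rac F -> (forall x, I0pi x -> 0 <= F x) ->
    {ae mu, forall x, I0pi x -> exists2 l, rD F x l & l <= f x * F x} ->
    forall x, I0pi x -> F x <= F 0 * K.
Proof.
move=> [g [g0 gi fg]].
exists (expR (\int[mu]_(t in `[0%R, pi]) g t)%R); first exact: expR_ge0.
move=> F aF F0 dF x Ix; apply: gronwall => //.
  by apply: F0; rewrite I0piE lexx pi_ge0.
apply: ae_imp2 fg dF => y h1 h2 Iy; have [l Fl lf] := h2 Iy; exists l => //.
by apply: le_trans lf _; rewrite ler_wpM2r ?F0 ?h1.
Qed.

End Domination.

(** * Matrix norms and the derivative of the squared Frobenius norm *)

Section MatrixNorm.
Context {R : realType} {m : nat}.
Implicit Types (A B : 'M[R[i]]_m) (c : R[i]).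

(** Working norm: submultiplicative, above the operator norm [mxnorm], and a plain sum, so
    domination passes from the entries to the matrix. *)
Definition mx1norm A : R := \sum_i \sum_j normc (A i j).

Lemma mx1norm_ge0 A : 0 <= mx1norm A.
Proof. by do 2! (apply: sumr_ge0 => ? _); exact: normc_ge0. Qed.

Lemma entry_le_mx1norm A i j : normc (A i j) <= mx1norm A.
Proof.
rewrite /mx1norm (bigD1 i) //= (bigD1 j) //= -addrA lerDl addr_ge0 // sumr_ge0 // => k _.
  exact: normc_ge0.
by apply: sumr_ge0 => l _; exact: normc_ge0.
Qed.

Lemma mx1normD A B : mx1norm (A + B) <= mx1norm A + mx1norm B.
Proof.
rewrite /mx1norm -big_split; apply: ler_sum => i _; rewrite -big_split; apply: ler_sum => j _.
by rewrite mxE; exact: le_normcD.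
Qed.

Lemma mx1normZ c A : mx1norm (c *: A) = normc c * mx1norm A.
Proof.
rewrite /mx1norm mulr_sumr; apply: eq_bigr => i _; rewrite mulr_sumr; apply: eq_bigr => j _.
by rewrite mxE normcM.
Qed.

Lemma mx1normN A : mx1norm (- A) = mx1norm A.
Proof. by rewrite /mx1norm; do 2! (apply: eq_bigr => ? _); rewrite mxE normcN. Qed.

Lemma normc_sum (I : Type) (r : seq I) (F : I -> R[i]) :
  normc (\sum_(i <- r) F i) <= \sum_(i <- r) normc (F i).
Proof.
elim: r => [|i r IH]; first by rewrite !big_nil normc0.
by rewrite !big_cons; apply: le_trans (le_normcD _ _) _; rewrite lerD2l.
Qed.

Lemma mx1normM A B : mx1norm (A *m B) <= mx1norm A * mx1norm B.
Proof.
rewrite /mx1norm mulr_suml; apply: ler_sum => i _; rewrite mulr_suml.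
apply: le_trans (_ : \sum_j \sum_k normc (A i k) * normc (B k j) <= _).
  apply: ler_sum => j _; rewrite mxE; apply: le_trans (normc_sum _ _) _.
  by apply: ler_sum => k _; rewrite normcM.
rewrite exchange_big; apply: ler_sum => k _; rewrite -mulr_sumr.
rewrite ler_wpM2l ?normc_ge0 // [leRHS](bigD1 k) //= lerDl.
by do 2! (apply: sumr_ge0 => ? _); exact: normc_ge0.
Qed.

Lemma mxnorm_le_mx1norm A : mxnorm A <= mx1norm A.
Proof.
apply: bigmax_le; first exact: mx1norm_ge0.
move=> i _; rewrite /mx1norm [leRHS](bigD1 i) //= lerDl.
by do 2! (apply: sumr_ge0 => ? _); exact: normc_ge0.
Qed.

Lemma mx1norm_le_max A (s : R) : (forall i j, normc (A i j) <= s) -> mx1norm A <= m%:R ^+ 2 * s.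
Proof.
move=> h; have E : \sum_(i < m) s = m%:R * s by rewrite sumr_const card_ord mulr_natl.
apply: le_trans (_ : \sum_(i < m) \sum_(j < m) s <= _).
  by do 2! (apply: ler_sum => ? _).
by rewrite E -mulr_sumr E mulrA.
Qed.

(** Squared Frobenius norm, as a polynomial in real and imaginary parts: it is differentiable
    wherever the entries are, even where the matrix vanishes. *)
Definition sqF A : R := \sum_i \sum_j (complex.Re (A i j) * complex.Re (A i j) +
  complex.Im (A i j) * complex.Im (A i j)).

Lemma sqFE A : sqF A = \sum_i \sum_j normc (A i j) ^+ 2.
Proof. by do 2! (apply: eq_bigr => ? _); rewrite normc_sqr !expr2. Qed.

Lemma sqF_ge0 A : 0 <= sqF A.
Proof. by rewrite sqFE; do 2! (apply: sumr_ge0 => ? _); exact: sqr_ge0. Qed.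

Lemma entry_sqF A i j : normc (A i j) ^+ 2 <= sqF A.
Proof.
rewrite sqFE (bigD1 i) //= (bigD1 j) //= -addrA lerDl addr_ge0 // sumr_ge0 // => k _.
  exact: sqr_ge0.
by apply: sumr_ge0 => l _; exact: sqr_ge0.
Qed.

Lemma sqF_le A : sqF A <= mx1norm A ^+ 2.
Proof.
rewrite sqFE expr2 [X in _ <= X * _]/mx1norm mulr_suml; apply: ler_sum => i _.
rewrite mulr_suml; apply: ler_sum => j _; rewrite expr2 ler_wpM2l ?normc_ge0 //.
exact: entry_le_mx1norm.
Qed.

Lemma rD_sum (I : Type) (r : seq I) (F : I -> R -> R) (x : R) (l : I -> R) :
  (forall i, rD (F i) x (l i)) -> rD (fun y => \sum_(i <- r) F i y) x (\sum_(i <- r) l i).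
Proof.
move=> h; elim: r => [|i r IH].
  rewrite big_nil (_ : (fun x => _) = fun _ => 0); first exact: rD_cst.
  by apply/funext => y; rewrite big_nil.
rewrite big_cons (_ : (fun x => _) = fun x => F i x + \sum_(i <- r) F i x); first exact: rD_add.
by apply/funext => y; rewrite big_cons.
Qed.

Lemma rac_sum (I : Type) (r : seq I) (F : I -> R -> R) :
  (forall i, rac (F i)) -> rac (fun y => \sum_(i <- r) F i y).
Proof.
move=> h; elim: r => [|i r IH].
  by apply: rac_ext (rac_cst 0) => x _; rewrite big_nil.
by apply: rac_ext (rac_add (h i) IH) => x _; rewrite big_cons.
Qed.

Lemma sqF_rac (d : R -> 'M[R[i]]_m) :
  (forall i j, cac (fun x => d x i j)) -> rac (fun x => sqF (d x)).
Proof.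
move=> h; apply: rac_sum => i; apply: rac_sum => j; have [h1 h2] := h i j.
by apply: rac_add; exact: rac_mul.
Qed.

Definition dsqF (d d' : 'M[R[i]]_m) : R := \sum_i \sum_j
  2 * (complex.Re (d i j) * complex.Re (d' i j) + complex.Im (d i j) * complex.Im (d' i j)).

Lemma sqF_rD (d : R -> 'M[R[i]]_m) (d' : 'M[R[i]]_m) x :
  (forall i j, cD (fun x => d x i j) x (d' i j)) ->
  rD (fun x => sqF (d x)) x (dsqF (d x) d').
Proof.
move=> h; apply: rD_sum => i; apply: rD_sum => j; have [h1 h2] := h i j.
set l := 2 * _.
have -> : l = (complex.Re (d' i j) * complex.Re (d x i j) + complex.Re (d x i j) * complex.Re (d' i j)) +
  (complex.Im (d' i j) * complex.Im (d x i j) + complex.Im (d x i j) * complex.Im (d' i j)).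
  by rewrite /l; ring.
by apply: rD_add; exact: rD_mul.
Qed.

(** The term [c *: d] contributes 2 Re c times the squared norm, which is nonpositive; the imaginary
    part of [c] only rotates the entries and cancels. *)
Lemma dsqF_le (d x : 'M[R[i]]_m) c (s : R) : complex.Re c <= 0 ->
  (forall i j, normc (d i j) <= s) -> dsqF d (c *: d + x) <= 2 * s * mx1norm x.
Proof.
move=> c0 ds; rewrite /mx1norm mulr_sumr; apply: ler_sum => i _; rewrite mulr_sumr.
apply: ler_sum => j _; rewrite -mulrA ler_pM2l // !mxE.
set z := d i j; set w := x i j.
rewrite Re_add Im_add Re_mul Im_mul.
have h1 : complex.Re z * complex.Re w + complex.Im z * complex.Im w <= s * normc w.
  apply: le_trans (dot_le _ _) _; rewrite ler_wpM2r ?normc_ge0 //; exact: ds.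
have h2 : complex.Re c * (complex.Re z ^+ 2 + complex.Im z ^+ 2) <= 0.
  by rewrite mulr_le0_ge0 // addr_ge0 ?sqr_ge0.
by move: h1 h2; rewrite !expr2; lra.
Qed.

Definition mreg (F F' : R -> 'M[R[i]]_m) :=
  forall i j, reg (fun x => F x i j) (fun x => F' x i j).

Lemma mreg_eq F F' G G' : mreg F F' -> (forall x, F x = G x) -> (forall x, F' x = G' x) ->
  mreg G G'.
Proof. by move=> h /funext <- /funext <-. Qed.

Lemma reg_eq (f f' g g' : R -> R[i]) : reg f f' -> (forall x, f x = g x) ->
  (forall x, f' x = g' x) -> reg g g'.
Proof. by move=> h /funext <- /funext <-. Qed.

Lemma mreg_add F F' G G' : mreg F F' -> mreg G G' ->
  mreg (fun x => F x + G x) (fun x => F' x + G' x).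
Proof.
by move=> h1 h2 i j; apply: reg_eq (reg_add (h1 i j) (h2 i j)) _ _ => x; rewrite mxE.
Qed.

Lemma mreg_scale f f' F F' : reg f f' -> mreg F F' ->
  mreg (fun x => f x *: F x) (fun x => f' x *: F x + f x *: F' x).
Proof.
by move=> h1 h2 i j; apply: reg_eq (reg_mul h1 (h2 i j)) _ _ => x; rewrite !mxE.
Qed.

Lemma mreg_cscale c F F' : mreg F F' -> mreg (fun x => c *: F x) (fun x => c *: F' x).
Proof.
move=> h; apply: mreg_eq (mreg_scale (reg_cst c) h) _ _ => x //.
by rewrite scale0r add0r.
Qed.

Lemma mreg_mul F F' G G' : mreg F F' -> mreg G G' ->
  mreg (fun x => F x *m G x) (fun x => F' x *m G x + F x *m G' x).
Proof.
move=> h1 h2 i j.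
apply: reg_eq (reg_sum (index_enum _) (fun k => reg_mul (h1 i k) (h2 k j))) _ _ => x.
  by rewrite mxE.
by rewrite !mxE big_split.
Qed.

End MatrixNorm.

(** * The remainder estimate *)

Section Estimate.
Context {R : realType} {m : nat}.
Implicit Types (F P Q U V d : R -> 'M[R[i]]_m).
Local Notation mu := (@lebesgue_measure R).

Definition mbounded F := exists2 M : R, 0 <= M & forall x, I0pi x -> mx1norm (F x) <= M.

Lemma bounded_sum (I : Type) (r : seq I) (f : I -> R -> R) :
  (forall i, exists2 M : R, 0 <= M & forall x, I0pi x -> f i x <= M) ->
  exists2 M : R, 0 <= M & forall x, I0pi x -> \sum_(i <- r) f i x <= M.
Proof.
move=> h; elim: r => [|i r [M M0 hM]]; first by exists 0 => // x _; rewrite big_nil.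
have [N N0 hN] := h i; exists (N + M); rewrite ?addr_ge0 // => x Ix.
by rewrite big_cons lerD ?hN ?hM.
Qed.

Lemma mbounded_entry F :
  (forall i j, exists2 M : R, 0 <= M & forall x, I0pi x -> normc (F x i j) <= M) -> mbounded F.
Proof. by move=> h; apply: bounded_sum => i; exact: bounded_sum. Qed.

Lemma mbounded_cac F : (forall i j, cac (fun x => F x i j)) -> mbounded F.
Proof. by move=> h; apply: mbounded_entry => i j; exact: cac_bounded. Qed.

Lemma mreg_mbounded F F' : mreg F F' -> mbounded F.
Proof. by move=> h; apply: mbounded_cac => i j; case: (h i j). Qed.

Lemma ae_forall (I : finType) (P : I -> R -> Prop) :
  (forall i, {ae mu, forall x, P i x}) -> {ae mu, forall x, forall i, P i x}.
Proof.
move=> h; suff : {ae mu, forall x, forall i, i \in enum I -> P i x}.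
  by apply: ae_imp => x hx i; apply: hx; rewrite mem_enum.
elim: (enum I) => [|i r IH]; first exact: aeW.
apply: ae_imp2 (h i) IH => x h1 h2 j; rewrite inE => /predU1P[->//|]; exact: h2.
Qed.

Lemma mxderive_cD F x : mxderivable F x -> forall i j, cD (fun y => F y i j) x (mxderive F x i j).
Proof. by move=> h i j; rewrite mxE; exact: cderivable_cD (h i j). Qed.

Lemma mreg_mxderive F : (forall x, I0pi x -> mxderivable F x) -> mbounded (mxderive F) ->
  mreg F (mxderive F).
Proof.
move=> h [M M0 hM] i j; apply: reg_cD => [x Ix|].
  by apply: mxderive_cD; exact: h.
by exists M => x Ix; apply: le_trans (hM x Ix); exact: entry_le_mx1norm.
Qed.

Lemma mbounded_mul F G : mbounded F -> mbounded G -> mbounded (fun x => F x *m G x).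
Proof.
move=> [M M0 hM] [N N0 hN]; exists (M * N); rewrite ?mulr_ge0 // => x Ix.
by apply: le_trans (mx1normM _ _) _; rewrite ler_pM ?mx1norm_ge0 ?hM ?hN.
Qed.

(** Bootstrap: P is differentiable, hence bounded; then P' = Q P is bounded, hence P is
    Lipschitz. *)
Lemma cauchy_mreg Q P : mbounded Q -> is_cauchy_solution Q P ->
  mreg P (fun x => Q x *m P x).
Proof.
move=> bQ [_ h].
have bP : mbounded P.
  apply: mbounded_entry => i j.
  apply: (@cD_bounded _ _ (fun x => mxderive P x i j)) => x /h[dP _].
  exact: mxderive_cD.
have [M M0 hM] := mbounded_mul bQ bP.
move=> i j; apply: reg_cD => [x /h[dP <-]|]; first exact: mxderive_cD.
by exists M => x Ix; apply: le_trans (hM x Ix); exact: entry_le_mx1norm.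
Qed.

Lemma W11_mreg Q : (forall i j, W1 1 (entry Q i j)) -> mreg Q (mxderive Q).
Proof.
move=> h i j; have [ac dQ _] := h i j; split; first exact: abs_continuous_cac.
by apply: ae_imp dQ => x h1 Ix; rewrite mxE; apply: cderivable_cD; exact: h1.
Qed.

(** Y' is absolutely continuous, hence bounded, which makes Y Lipschitz; Y'' is read off from the
    equation. *)
Lemma pencil_mreg Q1 Q0 rho (Y : R -> 'M[R[i]]_m) : is_pencil_solution Q1 Q0 rho Y ->
  mreg Y (mxderive Y) /\
  mreg (mxderive Y) (fun x => - (((rho ^+ 2)%:M + (2 * 'i%C * rho) *: Q1 x + Q0 x) *m Y x)).
Proof.
move=> [dY aY eqY].
have cY i j : cac (fun x => mxderive Y x i j) by apply: abs_continuous_cac; exact: aY.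
split; first by apply: mreg_mxderive => //; exact: mbounded_cac.
move=> i j; split=> //.
have := ae_oo_cc eqY; apply: ae_imp => x h Ix; have [dY1 E] := h Ix.
have -> : - (((rho ^+ 2)%:M + (2 * 'i%C * rho) *: Q1 x + Q0 x) *m Y x) = mxderive (mxderive Y) x.
  by apply/eqP; rewrite eq_sym -addr_eq0; apply/eqP.
exact: mxderive_cD.
Qed.

Lemma mx1norm_dominated F : (forall i j, L1 (entry F i j)) -> dominated (fun x => mx1norm (F x)).
Proof. by move=> h; do 2! (apply: dominated_sum => ?); apply: L1_dominated; exact: h. Qed.

(* The substitution that diagonalizes the system to first order, minus the
   leading term of the asymptotics. *)
Definition defect (kap al : R[i]) Q U V P (e : R -> R[i]) (x : R) : 'M[R[i]]_m :=
  U x + (- kap) *: (Q x *m V x) + (- al) *: (e x *: P x).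

(** All but [- Q d] has a factor [kap]. That term comes from the diagonal part - Q (U - al e P),
    rewritten with U - al e P = d + kap Q V; this explains the second [V x] in the term with two
    factors [Q x]. *)
Definition rest (kap : R[i]) Q Q' Q0 U V d (x : R) : 'M[R[i]]_m :=
  - (Q x *m d x) - kap *: (Q0 x *m (U x + V x) + Q' x *m V x +
     Q x *m (Q x *m (U x + V x + V x)) + kap *: (Q x *m (Q0 x *m (U x + V x)))).

(** The nonresonant term cancels because - Q V + kap ((k + T) + (k - T)) Q V = 0. The weight [T]
    drops out, being the same for [U] and [V]. *)
Lemma defect_mreg (k T al : R[i]) Q Q' Q0 U V P e : k != 0 ->
  let kap := (2 * k)^-1 in
  mreg Q Q' ->
  mreg U (fun x => (k - T) *: U x - Q x *m (U x + V x) - kap *: (Q0 x *m (U x + V x))) ->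
  mreg V (fun x => (- k - T) *: V x + Q x *m (U x + V x) + kap *: (Q0 x *m (U x + V x))) ->
  mreg P (fun x => - Q x *m P x) -> reg e (fun x => (k - T) * e x) ->
  let d := defect kap al Q U V P e in
  mreg d (fun x => (k - T) *: d x + rest kap Q Q' Q0 U V d x).
Proof.
move=> k0 kap hQ hU hV hP he d.
apply: mreg_eq (mreg_add (mreg_add hU (mreg_cscale (- kap) (mreg_mul hQ hV)))
  (mreg_cscale (- al) (mreg_scale he hP))) _ _ => x //.
rewrite /rest /d /defect.
rewrite !mulmxDr -?scalemxAr ?mulmxDr -?scalemxAr ?mulmxDr -?scalemxAr !mulNmx.
move: (Q x *m P x) (Q x *m U x) (Q x *m V x) (Q0 x *m U x) (Q0 x *m V x) (Q' x *m V x)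
  (U x) (V x) (P x) => QP QU QV Q0U Q0V Q'V u v p.
move: (Q x *m QP) (Q x *m QU) (Q x *m QV) (Q x *m Q0U) (Q x *m Q0V) => QQP QQU QQV QQ0U QQ0V.
apply/matrixP => i j; rewrite !mxE /kap.
by field.
Qed.

(** In the last factor, 2 g comes from Q0 and Q', 2 q^2 from Q Q (U + 2 V), and q g from Q Q0 after
    using |kap| <= 1 once. *)
Lemma rest_le (kap : R[i]) Q Q' Q0 U V d x (q g : R) :
  0 <= q -> 0 <= g -> normc kap <= 1 ->
  mx1norm (Q x) <= q -> mx1norm (Q' x) <= g -> mx1norm (Q0 x) <= g ->
  mx1norm (rest kap Q Q' Q0 U V d x) <= q * mx1norm (d x) +
    normc kap * ((mx1norm (U x) + mx1norm (V x)) * (2 * g + 2 * q ^+ 2 + q * g)).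
Proof.
move=> q0 g0 k1 hQ hQ' hQ0; set N := mx1norm (U x) + mx1norm (V x).
have U0 := mx1norm_ge0 (U x); have V0 := mx1norm_ge0 (V x); have N0 : 0 <= N by rewrite addr_ge0.
have mulQ (A B : 'M[R[i]]_m) a b : mx1norm A <= a -> mx1norm B <= b -> mx1norm (A *m B) <= a * b.
  by move=> h1 h2; apply: le_trans (mx1normM _ _) _; rewrite ler_pM ?mx1norm_ge0.
have hUV : mx1norm (U x + V x) <= N by exact: mx1normD.
have hUVV : mx1norm (U x + V x + V x) <= 2 * N.
  by apply: le_trans (mx1normD _ _) _; rewrite /N in hUV *; lra.
have h1 := mulQ _ _ _ _ hQ0 hUV.
have hV : mx1norm (V x) <= N by rewrite lerDr.
have h2 := mulQ _ _ _ _ hQ' hV.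
have h3 := mulQ _ _ _ _ hQ (mulQ _ _ _ _ hQ hUVV).
have h4 := mulQ _ _ _ _ hQ h1.
have h5 := mulQ _ _ _ _ hQ (lexx (mx1norm (d x))).
apply: le_trans (mx1normD _ _) _; rewrite !mx1normN mx1normZ lerD // ler_wpM2l ?normc_ge0 //.
have h6 : mx1norm (kap *: (Q x *m (Q0 x *m (U x + V x)))) <= q * (g * N).
  rewrite mx1normZ; apply: le_trans h4; rewrite ler_piMl ?mx1norm_ge0 //.
have := mx1normD (Q0 x *m (U x + V x)) (Q' x *m V x).
have := mx1normD (Q0 x *m (U x + V x) + Q' x *m V x) (Q x *m (Q x *m (U x + V x + V x))).
have := mx1normD (Q0 x *m (U x + V x) + Q' x *m V x + Q x *m (Q x *m (U x + V x + V x)))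
  (kap *: (Q x *m (Q0 x *m (U x + V x)))).
by rewrite expr2; lra.
Qed.

(* [f] below is chosen so that E' <= f (E + del^2); s is the square root of E,
   hence a bound for the entries of d1 and d2. *)
Lemma pair_estimate (g : R -> R) (q p : R) : (forall x, 0 <= g x) -> dominated g ->
  0 <= q -> 0 <= p ->
  exists2 K : R, 0 <= K & forall (kap c : R) (c1 c2 : R[i]) (d1 d2 X1 X2 : R -> 'M[R[i]]_m) (N : R -> R),
    0 <= kap -> kap <= 1 -> 0 <= c ->
    complex.Re c1 <= 0 -> complex.Re c2 <= 0 ->
    mreg d1 (fun x => c1 *: d1 x + X1 x) -> mreg d2 (fun x => c2 *: d2 x + X2 x) ->
    {ae mu, forall x, I0pi x ->
      mx1norm (X1 x) <= q * mx1norm (d1 x) + kap * (N x * (2 * g x + 2 * q ^+ 2 + q * g x)) /\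
      mx1norm (X2 x) <= q * mx1norm (d2 x) + kap * (N x * (2 * g x + 2 * q ^+ 2 + q * g x))} ->
    (forall x, I0pi x -> N x <= 2 * (mx1norm (d1 x) + mx1norm (d2 x)) + 4 * c * p) ->
    mx1norm (d1 0) <= kap * c * q -> mx1norm (d2 0) <= kap * c * q ->
    forall x, I0pi x -> mx1norm (d1 x) <= K * (kap * c) /\ mx1norm (d2 x) <= K * (kap * c).
Proof.
move=> g0 dg q0 p0; pose M : R := m%:R ^+ 2.
have M0 : 0 <= M by exact: sqr_ge0.
pose h x := 2 * g x + 2 * q ^+ 2 + q * g x.
have h0 x : 0 <= h x by rewrite !addr_ge0 ?mulr_ge0 ?sqr_ge0.
have dh : dominated h.
  apply: dominated_add; last exact: dominated_scale.
  apply: dominated_add; first exact: dominated_scale.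
  by apply: dominated_cst; rewrite mulr_ge0 ?sqr_ge0.
(* Below, E' <= 4 s (q M s + 4 M s h + 4 del p h). The mixed term 16 p h s del is at most 8 p h (s^2
   + del^2), and the rest gives 4 q M + 16 M h. *)
pose f x := 4 * q * M + (16 * M + 8 * p) * h x.
have df : dominated f.
  apply: dominated_add; first by apply: dominated_cst; rewrite !mulr_ge0.
  by apply: dominated_scale dh; rewrite addr_ge0 ?mulr_ge0.
have [K0 K00 HK] := gronwall_dominated df.
(* The initial bounds give E 0 <= 2 (del q)^2, so the Gronwall quantity starts below (2 q^2 + 1)
   del^2. *)
pose L := (2 * q ^+ 2 + 1) * K0.
have L0 : 0 <= L by rewrite mulr_ge0 // addr_ge0 ?mulr_ge0 ?sqr_ge0.
exists (M * (1 + L)); first by rewrite mulr_ge0 // addr_ge0.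
move=> kap c c1 c2 d1 d2 X1 X2 N kap0 kap1 c0 Rc1 Rc2 hd1 hd2 hX hN hd10 hd20 x Ix.
pose E y := sqF (d1 y) + sqF (d2 y).
have E0 y : 0 <= E y by rewrite addr_ge0 ?sqF_ge0.
pose s y := Num.sqrt (E y).
have s0 y : 0 <= s y by exact: sqrtr_ge0.
have sE y : s y ^+ 2 = E y by rewrite sqr_sqrtr.
have e1 y i j : normc (d1 y i j) <= s y.
  rewrite -(ler_sqr (normc_ge0 _) (s0 y)) sE; apply: le_trans (entry_sqF _ _ _) _.
  by rewrite lerDl sqF_ge0.
have e2 y i j : normc (d2 y i j) <= s y.
  rewrite -(ler_sqr (normc_ge0 _) (s0 y)) sE; apply: le_trans (entry_sqF _ _ _) _.
  by rewrite lerDr sqF_ge0.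
have n1d1 y : mx1norm (d1 y) <= M * s y by exact: mx1norm_le_max.
have n1d2 y : mx1norm (d2 y) <= M * s y by exact: mx1norm_le_max.
set del := kap * c in hd10 hd20 *.
have del0 : 0 <= del by rewrite mulr_ge0.
(* Adding the constant [del ^+ 2] makes the differential inequality homogeneous. *)
have aE : rac (fun y => E y + del ^+ 2).
  apply: rac_add; last exact: rac_cst.
  by apply: rac_add; apply: sqF_rac => i j; [case: (hd1 i j)|case: (hd2 i j)].
have aeall F F' : mreg F F' ->
    {ae mu, forall y, I0pi y -> forall i j, cD (fun t => F t i j) y (F' y i j)}.
  move=> hF; have : {ae mu, forall y, forall i j, I0pi y -> cD (fun t => F t i j) y (F' y i j)}.
    by apply: ae_forall => i; apply: ae_forall => j; case: (hF i j).
  by apply: ae_imp => y hy Iy i j; exact: hy.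
have EK : E x + del ^+ 2 <= (E 0 + del ^+ 2) * K0.
  apply: HK aE _ _ x Ix => [y _|]; first by rewrite addr_ge0 ?sqr_ge0.
  apply: ae_imp2 (ae_imp2 _ (aeall _ _ hd1) (aeall _ _ hd2)) hX; last first.
    by move=> y a b; exact: (conj a b).
  move=> y [D1 D2] hXy Iy; have [x1 x2] := hXy Iy.
  exists (dsqF (d1 y) (c1 *: d1 y + X1 y) + dsqF (d2 y) (c2 *: d2 y + X2 y) + 0).
    apply: rD_add; last exact: rD_cst.
    by apply: rD_add; apply: sqF_rD => i j; [exact: D1|exact: D2].
  have l1 := dsqF_le (X1 y) Rc1 (e1 y).
  have l2 := dsqF_le (X2 y) Rc2 (e2 y).
  have Ny : N y <= 4 * M * s y + 4 * c * p.
    by apply: le_trans (hN y Iy) _; have := n1d1 y; have := n1d2 y; lra.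
  (* The factor [kap <= 1] is dropped in front of [s], but kept in front of [c], where it forms
     [del]. *)
  have kN : kap * (N y * h y) <= 4 * M * s y * h y + 4 * del * p * h y.
    apply: le_trans (_ : kap * ((4 * M * s y + 4 * c * p) * h y) <= _).
      by rewrite ler_wpM2l // ler_wpM2r.
    rewrite /del -subr_ge0.
    have -> : 4 * M * s y * h y + 4 * (kap * c) * p * h y - kap * ((4 * M * s y + 4 * c * p) * h y)
      = (1 - kap) * (4 * M * s y * h y) by ring.
    by rewrite mulr_ge0 ?subr_ge0 // !mulr_ge0.
  have qd1 : q * mx1norm (d1 y) <= q * (M * s y) by rewrite ler_wpM2l.
  have qd2 : q * mx1norm (d2 y) <= q * (M * s y) by rewrite ler_wpM2l.
  pose B := q * (M * s y) + (4 * M * s y * h y + 4 * del * p * h y).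
  have B1 : mx1norm (X1 y) <= B by apply: le_trans x1 _; rewrite lerD.
  have B2 : mx1norm (X2 y) <= B by apply: le_trans x2 _; rewrite lerD.
  have sB1 : 2 * s y * mx1norm (X1 y) <= 2 * s y * B by rewrite ler_wpM2l // mulr_ge0.
  have sB2 : 2 * s y * mx1norm (X2 y) <= 2 * s y * B by rewrite ler_wpM2l // mulr_ge0.
  have : 4 * s y * B <= f y * (E y + del ^+ 2).
    rewrite -sE /B /f -subr_ge0.
    have -> : (4 * q * M + (16 * M + 8 * p) * h y) * (s y ^+ 2 + del ^+ 2) -
       4 * s y * (q * (M * s y) + (4 * M * s y * h y + 4 * del * p * h y)) =
       4 * q * M * del ^+ 2 + 16 * M * h y * del ^+ 2 + 8 * p * h y * (s y - del) ^+ 2 by ring.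
    by rewrite !addr_ge0 // mulr_ge0 ?sqr_ge0 // !mulr_ge0 //.
  by lra.
have dq0 : 0 <= del * q by rewrite mulr_ge0.
have sq1 : sqF (d1 0) <= (del * q) ^+ 2.
  by apply: le_trans (sqF_le _) _; rewrite ler_sqr ?nnegrE ?mx1norm_ge0.
have sq2 : sqF (d2 0) <= (del * q) ^+ 2.
  by apply: le_trans (sqF_le _) _; rewrite ler_sqr ?nnegrE ?mx1norm_ge0.
(* L <= (1 + L)^2 spares a square root in the constant. *)
have sx : s x <= (1 + L) * del.
  have b0 : 0 <= (1 + L) * del by rewrite mulr_ge0 // addr_ge0.
  rewrite -(ler_sqr (s0 x) b0) sE.
  have h1 : (E 0 + del ^+ 2) * K0 <= L * del ^+ 2.
    have -> : L * del ^+ 2 = (2 * q ^+ 2 + 1) * del ^+ 2 * K0 by rewrite /L; ring.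
    by rewrite ler_wpM2r // /E; move: sq1 sq2; rewrite exprMn; lra.
  have h2 : L * del ^+ 2 <= ((1 + L) * del) ^+ 2.
    rewrite -subr_ge0 (_ : _ - _ = (1 + L + L ^+ 2) * del ^+ 2); last by ring.
    by rewrite mulr_ge0 ?sqr_ge0 // !addr_ge0 ?sqr_ge0.
  by have := sqr_ge0 del; lra.
have Ms : M * s x <= M * (1 + L) * del by rewrite -mulrA ler_wpM2l.
by split; [apply: le_trans (n1d1 x) Ms|apply: le_trans (n1d2 x) Ms].
Qed.

End Estimate.

(** * Algebra of the splitting into two halves *)

Section HalfAlgebra.
Context {F : fieldType} {m : nat}.
Implicit Types (y a b : 'M[F]_m).

Lemma half_sumE (l v : F) y y1 : (2 : F) != 0 ->
  2^-1 *: (v *: (y + l *: y1)) + 2^-1 *: (v *: (y + (- l) *: y1)) = v *: y.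
Proof. by move=> two0; apply/matrixP => i j; rewrite !mxE; field. Qed.

Lemma half_diffE (k v : F) y y1 : (2 : F) != 0 -> k != 0 ->
  k *: (2^-1 *: (v *: (y + k^-1 *: y1)) - 2^-1 *: (v *: (y + (- k^-1) *: y1))) = v *: y1.
Proof. by move=> two0 k0; apply/matrixP => i j; rewrite !mxE; field; rewrite k0 two0. Qed.

(** Here [y1], [a], [b] stand for Y', Q1 Y, Q0 Y, and the bracket in [k] is Y'' after substituting k
    = i rho. *)
Lemma half_deriveE (k T v : F) y y1 a b : (2 : F) != 0 -> k != 0 ->
  2^-1 *: ((- T * v) *: (y + k^-1 *: y1) +
    v *: (y1 + k^-1 *: (k ^+ 2 *: y - (2 * k) *: a - b))) =
  (k - T) *: (2^-1 *: (v *: (y + k^-1 *: y1))) - v *: a - (2 * k)^-1 *: (v *: b).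
Proof. by move=> two0 k0; apply/matrixP => i j; rewrite !mxE; field; rewrite k0 two0. Qed.

End HalfAlgebra.

(** * Asymptotics of the two halves *)

Section Asymptotics.
Context {R : realType} {m : nat}.
Implicit Types (F P Q U V d : R -> 'M[R[i]]_m).
Local Notation mu := (@lebesgue_measure R).

(** Undoes the substitution: U - al e P = d + kap Q V. The first bound is the wanted error, the
    second feeds the a priori bound of |U| + |V|. *)
Lemma defect_le (kap al : R[i]) Q U V P (e : R -> R[i]) x (q p : R) :
  mx1norm (Q x) <= q -> mx1norm (P x) <= p -> normc (e x) <= 1 ->
  let d := defect kap al Q U V P e in
  mx1norm (U x - (al * e x) *: P x) <= mx1norm (d x) + normc kap * q * mx1norm (V x) /\
  mx1norm (U x) <= mx1norm (d x) + normc kap * q * mx1norm (V x) + normc al * p.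
Proof.
move=> hQ hP he d.
have E : U x - (al * e x) *: P x = d x + kap *: (Q x *m V x).
  by rewrite /d /defect; apply/matrixP => i j; rewrite !mxE; ring.
have h1 : mx1norm (U x - (al * e x) *: P x) <= mx1norm (d x) + normc kap * q * mx1norm (V x).
  rewrite E; apply: le_trans (mx1normD _ _) _; rewrite lerD2l mx1normZ -mulrA ler_wpM2l ?normc_ge0 //.
  by apply: le_trans (mx1normM _ _) _; rewrite ler_wpM2r ?mx1norm_ge0.
split=> //; have -> : U x = U x - (al * e x) *: P x + (al * e x) *: P x by rewrite subrK.
apply: le_trans (mx1normD _ _) _; rewrite lerD // mx1normZ normcM -mulrA ler_wpM2l ?normc_ge0 //.
by rewrite -[p]mul1r ler_pM ?normc_ge0 ?mx1norm_ge0.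
Qed.

(* [half k] and [half (- k)] are u and v, multiplied by the weight [w]. *)
Definition half (k : R[i]) (w : R -> R[i]) (Y Y1 : R -> 'M[R[i]]_m) (x : R) : 'M[R[i]]_m :=
  2^-1 *: (w x *: (Y x + k^-1 *: Y1 x)).

Let two0 : (2 : R[i]) != 0. Proof. by rewrite pnatr_eq0. Qed.

Lemma half_sum k w Y Y1 x : half k w Y Y1 x + half (- k) w Y Y1 x = w x *: Y x.
Proof. by rewrite /half invrN half_sumE. Qed.

Lemma half_diff k w Y Y1 x : k != 0 ->
  k *: (half k w Y Y1 x - half (- k) w Y Y1 x) = w x *: Y1 x.
Proof. by move=> k0; rewrite /half invrN half_diffE. Qed.

(** The equation Y'' = k^2 Y - 2 k Q Y - Q0 Y is invariant under (k, Q) -> (- k, - Q), which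
    exchanges the halves; each computation is therefore made once and reused for [V]. *)
Lemma half_mreg (k T : R[i]) (w : R -> R[i]) Q Q0 (Y Y1 : R -> 'M[R[i]]_m) : k != 0 ->
  reg w (fun x => - T * w x) -> mreg Y Y1 ->
  mreg Y1 (fun x => k ^+ 2 *: Y x - (2 * k) *: (Q x *m Y x) - Q0 x *m Y x) ->
  mreg (half k w Y Y1) (fun x => (k - T) *: half k w Y Y1 x
    - Q x *m (half k w Y Y1 x + half (- k) w Y Y1 x)
    - (2 * k)^-1 *: (Q0 x *m (half k w Y Y1 x + half (- k) w Y Y1 x))).
Proof.
move=> k0 rw rY rY1.
apply: mreg_eq (mreg_cscale 2^-1 (mreg_scale rw (mreg_add rY (mreg_cscale k^-1 rY1)))) _ _ => x //.
by rewrite !half_sum /half -!scalemxAr half_deriveE.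
Qed.

Lemma split_mreg (k : R[i]) (t : R) (al be : R[i]) Q Q0 (Y Y1 : R -> 'M[R[i]]_m) : k != 0 ->
  mreg Y Y1 ->
  mreg Y1 (fun x => k ^+ 2 *: Y x - (2 * k) *: (Q x *m Y x) - Q0 x *m Y x) ->
  Y 0 = (al + be)%:M -> Y1 0 = (k * (al - be))%:M ->
  exists U V,
    [/\ mreg U (fun x => (k - t%:C) *: U x - Q x *m (U x + V x) - (2 * k)^-1 *: (Q0 x *m (U x + V x))),
        mreg V (fun x => (- k - t%:C) *: V x - (- Q x) *m (V x + U x)
                           - (2 * - k)^-1 *: (Q0 x *m (V x + U x))),
        U 0 = al%:M /\ V 0 = be%:M &
        forall x, Y x = cexp (t%:C * x%:C) *: (U x + V x) /\
                  Y1 x = (k * cexp (t%:C * x%:C)) *: (U x - V x)].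
Proof.
move=> k0 rY rY1 Y0 Y10.
pose w (x : R) := cexp (- t%:C * x%:C).
exists (half k w Y Y1), (half (- k) w Y Y1); split.
- by apply: half_mreg => //; exact: reg_cexp.
- have nk0 : - k != 0 by rewrite oppr_eq0.
  have := @half_mreg (- k) t%:C w (fun x => - Q x) Q0 Y Y1 nk0 (reg_cexp _) rY.
  rewrite opprK; apply; apply: mreg_eq rY1 (fun=> erefl) _ => x.
  by rewrite sqrrN mulNmx mulrN scaleNr scalerN opprK.
- have w0 : w 0 = 1 by rewrite /w mulr0 cexp0.
  rewrite /half w0 Y0 Y10 !scale1r !scale_scalar_mx -!raddfD /= !scale_scalar_mx invrN mulNr mulKf //.
  by split; congr (_%:M); rewrite -[RHS](mulKf two0); congr (_ * _); ring.
- move=> x; have Ww : cexp (t%:C * x%:C) * w x = 1.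
    by rewrite -cexpD -mulrDl subrr mul0r cexp0.
  rewrite half_sum scalerA Ww scale1r; split=> //.
  by rewrite mulrC -scalerA half_diff // scalerA Ww scale1r.
Qed.

Lemma normc_cexp_le1 (c : R[i]) (y : R) : complex.Re c <= 0 -> I0pi y -> normc (cexp (c * y%:C)) <= 1.
Proof.
move=> c0; rewrite I0piE => /andP[y0 _].
by rewrite normc_cexp Re_mul /= mulr0 subr0 -expR0 ler_expR mulr_le0_ge0.
Qed.

(** At 0 the leading term cancels [U] exactly, so only the correction, of order [kap], is left as
    initial value. *)
Lemma defect_0 (kap al be : R[i]) Q U V P e : U 0 = al%:M -> V 0 = be%:M -> P 0 = 1%:M -> e 0 = 1 ->
  defect kap al Q U V P e 0 = (- kap * be) *: Q 0.
Proof.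
move=> U0 V0 P0 e0; rewrite /defect U0 V0 P0 e0 mul_mx_scalar.
by apply/matrixP => i j; rewrite !mxE; ring.
Qed.

Lemma mx1norm_defect_0 (kap al be : R[i]) Q U V P e (q : R) : U 0 = al%:M -> V 0 = be%:M ->
  P 0 = 1%:M -> e 0 = 1 -> mx1norm (Q 0) <= q ->
  mx1norm (defect kap al Q U V P e 0) <= normc kap * (normc al + normc be) * q.
Proof.
move=> U0 V0 P0 e0 hq; rewrite (defect_0 _ _ U0 V0 P0 e0) mx1normZ normcM normcN.
rewrite ler_pM ?mx1norm_ge0 ?mulr_ge0 ?normc_ge0 //.
by rewrite ler_wpM2l ?normc_ge0 // lerDr normc_ge0.
Qed.

Lemma split_asymptotics (Q0 Q1 Pp Pm : R -> 'M[R[i]]_m) :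
  (forall i j, W1 0 (entry Q0 i j)) -> (forall i j, W1 1 (entry Q1 i j)) ->
  is_cauchy_solution Q1 Pp -> is_cauchy_solution (fun x => - Q1 x) Pm ->
  exists K r : R, 0 < r /\ forall (k al be : R[i]) (t : R) U V, r <= normc k ->
    complex.Re (k - t%:C) <= 0 -> complex.Re (- k - t%:C) <= 0 ->
    mreg U (fun x => (k - t%:C) *: U x - Q1 x *m (U x + V x)
                       - (2 * k)^-1 *: (Q0 x *m (U x + V x))) ->
    mreg V (fun x => (- k - t%:C) *: V x - (- Q1 x) *m (V x + U x)
                       - (2 * - k)^-1 *: (Q0 x *m (V x + U x))) ->
    U 0 = al%:M -> V 0 = be%:M ->
    forall x, I0pi x ->
    mx1norm (U x - (al * cexp ((k - t%:C) * x%:C)) *: Pm x) <= K * ((normc al + normc be) / normc k) /\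
    mx1norm (V x - (be * cexp ((- k - t%:C) * x%:C)) *: Pp x) <= K * ((normc al + normc be) / normc k).
Proof.
move=> hQ0 hQ1 hPp hPm.
have rQ : mreg Q1 (mxderive Q1) by exact: W11_mreg.
have rNQ : mreg (fun x => - Q1 x) (fun x => - mxderive Q1 x).
  by apply: mreg_eq (mreg_cscale (-1) rQ) _ _ => x; rewrite scaleN1r.
have bQ := mreg_mbounded rQ; have [q q0 hq] := bQ.
have rPp := cauchy_mreg bQ hPp.
have rPm := cauchy_mreg (mreg_mbounded rNQ) hPm.
have [pp pp0 hpp] := mreg_mbounded rPp; have [pm pm0 hpm] := mreg_mbounded rPm.
have [p p0 [hm hp]] : exists2 p : R, 0 <= p &
    (forall y, I0pi y -> mx1norm (Pm y) <= p) /\ (forall y, I0pi y -> mx1norm (Pp y) <= p).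
  exists (pp + pm); first by rewrite addr_ge0.
  by split=> y Iy; [apply: le_trans (hpm y Iy) _|apply: le_trans (hpp y Iy) _];
    rewrite ?lerDr ?lerDl.
have dQ0 : dominated (fun x => mx1norm (Q0 x)) by exact: mx1norm_dominated.
have dQ' : dominated (fun x => mx1norm (mxderive Q1 x)).
  apply: mx1norm_dominated => i j; have [_ _ ] := hQ1 i j.
  by congr L1; apply/funext => x; rewrite /entry mxE.
pose g x := mx1norm (Q0 x) + mx1norm (mxderive Q1 x).
have g0 x : 0 <= g x by rewrite addr_ge0 ?mx1norm_ge0.
have [K K0 hK] := @pair_estimate R m g q p g0 (dominated_add dQ0 dQ') q0 p0.
(* [K] bounds the defect; the second summand pays for the correction kap Q V, since |U| + |V| <= (4
   K + 4 p) c. *)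
pose K' := K + q * (4 * K + 4 * p).
(* |k| >= 1 + q gives |kap| <= 1 and |kap| q <= 1 / 2, as the absorption below requires. *)
exists K', (1 + q); split; first by rewrite ltr_wpDr.
move=> k al be t U V rk R1 R2 rU rV U0 V0 x Ix.
have nk0 : 0 < normc k by lra.
have k0 : k != 0 by apply/eqP => E; move: nk0; rewrite E normc0 ltxx.
have mk0 : - k != 0 by rewrite oppr_eq0.
have [kap Ekap] : {kap | kap = (2 * k)^-1} by exists (2 * k)^-1.
have kapN : (2 * - k)^-1 = - kap by rewrite mulrN invrN Ekap.
have nkap : normc kap = (2 * normc k)^-1.
  rewrite Ekap normcV normcM (_ : normc 2 = 2) //.
  by rewrite (_ : 2 = 2%:C) ?normc_real ?ger0_norm // rmorph_nat.
have nkap0 : 0 <= normc kap by exact: normc_ge0.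
have kapq : normc kap * q <= 1 / 2.
  rewrite nkap mulrC ler_pdivrMr; last by lra.
  by lra.
have kap1 : normc kap <= 1 by rewrite nkap invf_le1; lra.
have [e1 E1] : {e1 | e1 = fun x : R => cexp ((k - t%:C) * x%:C)} by eexists.
have [e2 E2] : {e2 | e2 = fun x : R => cexp ((- k - t%:C) * x%:C)} by eexists.
have [d1 Ed1] : {d | d = defect kap al Q1 U V Pm e1} by eexists.
have [d2 Ed2] : {d | d = defect (- kap) be (fun x => - Q1 x) V U Pp e2} by eexists.
have rd1 : mreg d1 (fun x => (k - t%:C) *: d1 x + rest kap Q1 (mxderive Q1) Q0 U V d1 x).
  rewrite Ed1 Ekap; have := @defect_mreg R m k t%:C al Q1 (mxderive Q1) Q0 U V Pm e1 k0 rQ rU _ rPm _; apply; last by rewrite E1; exact: reg_cexp.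
  apply: mreg_eq rV (fun=> erefl) _ => y; rewrite kapN -Ekap mulNmx opprK scaleNr opprK.
  by rewrite [V y + U y]addrC.
have rd2 : mreg d2 (fun x => (- k - t%:C) *: d2 x +
    rest (- kap) (fun x => - Q1 x) (fun x => - mxderive Q1 x) Q0 V U d2 x).
  rewrite Ed2 -kapN; have := @defect_mreg R m (- k) t%:C be (fun x => - Q1 x) (fun x => - mxderive Q1 x) Q0 V U Pp e2 mk0 rNQ rV; apply; last by rewrite E2; exact: reg_cexp.
  - apply: mreg_eq rU (fun=> erefl) _ => y; rewrite opprK kapN Ekap mulNmx scaleNr.
    by rewrite [V y + U y]addrC.
  - by apply: mreg_eq rPp (fun=> erefl) _ => y; rewrite opprK.
have [c Ec] : {c | c = normc al + normc be} by eexists.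
have al0 := normc_ge0 al; have be0 := normc_ge0 be.
have c0 : 0 <= c by rewrite Ec addr_ge0.
have hUV y : I0pi y ->
    [/\ mx1norm (U y - (al * e1 y) *: Pm y) <= mx1norm (d1 y) + normc kap * q * mx1norm (V y),
        mx1norm (U y) <= mx1norm (d1 y) + normc kap * q * mx1norm (V y) + normc al * p,
        mx1norm (V y - (be * e2 y) *: Pp y) <= mx1norm (d2 y) + normc kap * q * mx1norm (U y) &
        mx1norm (V y) <= mx1norm (d2 y) + normc kap * q * mx1norm (U y) + normc be * p].
  move=> Iy.
  have hNq : mx1norm (- Q1 y) <= q by rewrite mx1normN hq.
  have ne1 : normc (e1 y) <= 1 by rewrite E1 normc_cexp_le1.
  have ne2 : normc (e2 y) <= 1 by rewrite E2 normc_cexp_le1.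
  have [h1 h2] := defect_le kap al U V (hq y Iy) (hm y Iy) ne1.
  have [h3 h4] := @defect_le (- kap) be (fun x => - Q1 x) V U Pp e2 y q p hNq (hp y Iy) ne2.
  by rewrite Ed1 Ed2; rewrite normcN in h3 h4; split.
(* In the sum of the two bounds of [hUV], at most half of |U| + |V| stands on the right; absorbing
   it doubles the rest. *)
have hN y : I0pi y -> mx1norm (U y) + mx1norm (V y) <= 2 * (mx1norm (d1 y) + mx1norm (d2 y)) + 4 * c * p.
  move=> /hUV[_ h1 _ h2].
  have h3 : normc kap * q * mx1norm (U y) <= 1 / 2 * mx1norm (U y) by rewrite ler_wpM2r ?mx1norm_ge0.
  have h4 : normc kap * q * mx1norm (V y) <= 1 / 2 * mx1norm (V y) by rewrite ler_wpM2r ?mx1norm_ge0.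
  have h5 : 0 <= c * p by rewrite mulr_ge0.
  have h6 : c * p = normc al * p + normc be * p by rewrite Ec mulrDl.
  by clear - h1 h2 h3 h4 h5 h6; lra.
have I0 : I0pi (0 : R) by rewrite I0piE lexx pi_ge0.
have d10 : mx1norm (d1 0) <= normc kap * c * q.
  by rewrite Ed1 Ec; apply: mx1norm_defect_0 => //; rewrite ?hq ?E1 ?mulr0 ?cexp0 //; exact: hPm.1.
have d20 : mx1norm (d2 0) <= normc kap * c * q.
  rewrite Ed2 Ec -(normcN kap) addrC.
  by apply: mx1norm_defect_0 => //; rewrite ?mx1normN ?hq ?E2 ?mulr0 ?cexp0 //; exact: hPp.1.
have [|D1 D2] := hK (normc kap) c _ _ d1 d2 _ _ (fun y => mx1norm (U y) + mx1norm (V y)) nkap0 kap1 c0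
  R1 R2 rd1 rd2 _ hN d10 d20 x Ix.
  apply: aeW => y Iy.
  have gQ0 : mx1norm (Q0 y) <= g y by rewrite lerDl mx1norm_ge0.
  have gQ' : mx1norm (mxderive Q1 y) <= g y by rewrite lerDr mx1norm_ge0.
  split; first by apply: rest_le => //; exact: hq.
  rewrite -(normcN kap) [mx1norm (U y) + _]addrC.
  by apply: rest_le => //; rewrite ?normcN ?mx1normN // hq.
have [h1 _ h2 _] := hUV x Ix.
have NU := mx1norm_ge0 (U x); have NV := mx1norm_ge0 (V x).
have NN : mx1norm (U x) + mx1norm (V x) <= (4 * K + 4 * p) * c.
  have kc : normc kap * c <= c by rewrite ler_piMl.
  have Kc : K * (normc kap * c) <= K * c by rewrite ler_wpM2l.
  have hNx := hN x Ix.
  by clear - D1 D2 kc Kc hNx; lra.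
have kq0 : 0 <= normc kap * q by rewrite mulr_ge0.
have B : normc kap * q * ((4 * K + 4 * p) * c) + K * (normc kap * c) = K' * (normc kap * c).
  by rewrite /K'; ring.
have kU : normc kap * q * mx1norm (U x) <= normc kap * q * ((4 * K + 4 * p) * c).
  by rewrite ler_wpM2l //; clear - NN NV; lra.
have kV : normc kap * q * mx1norm (V x) <= normc kap * q * ((4 * K + 4 * p) * c).
  by rewrite ler_wpM2l //; clear - NN NU; lra.
have K'0 : 0 <= K' by rewrite addr_ge0 // mulr_ge0 // addr_ge0 // mulr_ge0.
have kc : normc kap * c <= c / normc k.
  by rewrite nkap mulrC ler_wpM2l // lef_pV2 ?posrE //; clear - nk0; lra.
have K'c : K' * (normc kap * c) <= K' * (c / normc k) by rewrite ler_wpM2l.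
rewrite -Ec; move: h1 h2; rewrite E1 E2 => h1 h2.
by clear - h1 h2 K'c kU kV B D1 D2; split; lra.
Qed.

End Asymptotics.

Section FinalAlgebra.
Context {F : pzRingType} {m : nat}.
Implicit Types (A B : 'M[F]_m).

(** [W] is exp(|tau| x), pulled out of the solution and of both exponentials, so that the weighted
    remainders appear. *)
Lemma factor_sum (W a b e1 e2 : F) (u v A B : 'M[F]_m) : a * (W * e1) = W * (a * e1) ->
  b * (W * e2) = W * (b * e2) ->
  W *: (u + v) - ((a * (W * e1)) *: A + (b * (W * e2)) *: B) =
  W *: ((u - (a * e1) *: A) + (v - (b * e2) *: B)).
Proof.
by move=> -> ->; rewrite -!scalerA !scalerDr !scalerN opprD addrACA.
Qed.

Lemma factor_diff (W a b e1 e2 : F) (u v A B : 'M[F]_m) : a * (W * e1) = W * (a * e1) ->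
  b * (W * e2) = W * (b * e2) ->
  W *: (u - v) - ((a * (W * e1)) *: A - (b * (W * e2)) *: B) =
  W *: ((u - (a * e1) *: A) - (v - (b * e2) *: B)).
Proof.
move=> -> ->; rewrite -!scalerA -!scalerBr; congr (_ *: _).
rewrite !opprB -!addrA; congr (_ + _); rewrite addrCA [RHS]addrCA; congr (_ + _).
exact: addrC.
Qed.

End FinalAlgebra.

(** * Return to the solutions of the pencil *)

Section Main.
Context {R : realType} {m : nat}.

Lemma pencil_asymptotics (Q0 Q1 Pp Pm : R -> 'M[R[i]]_m) :
  (forall i j, W1 0 (entry Q0 i j)) -> (forall i j, W1 1 (entry Q1 i j)) ->
  is_cauchy_solution Q1 Pp -> is_cauchy_solution (fun x => - Q1 x) Pm ->
  exists K r : R, 0 < r /\ forall (rho al be : R[i]) (Y : R -> 'M[R[i]]_m), r <= normc rho ->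
    is_pencil_solution Q1 Q0 rho Y ->
    Y 0 = (al + be)%:M -> mxderive Y 0 = ('i%C * rho * (al - be))%:M ->
    forall x, I0pi x ->
    mx1norm (Y x - ((al * cexp ('i%C * rho * x%:C)) *: Pm x +
               (be * cexp (- 'i%C * rho * x%:C)) *: Pp x))
      <= K * ((normc al + normc be) / normc rho) * expR (`|complex.Im rho| * x) /\
    mx1norm (mxderive Y x - ('i%C * rho) *: ((al * cexp ('i%C * rho * x%:C)) *: Pm x -
               (be * cexp (- 'i%C * rho * x%:C)) *: Pp x))
      <= K * (normc al + normc be) * expR (`|complex.Im rho| * x).
Proof.
move=> hQ0 hQ1 hPp hPm.
have [K [r [r0 hK]]] := split_asymptotics hQ0 hQ1 hPp hPm.
exists (2 * K), r; split=> // rho al be Y rrho hY Y0 Y'0 x Ix.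
have nr0 : 0 < normc rho by exact: lt_le_trans rrho.
have rho0 : rho != 0 by apply/eqP => E; move: nr0; rewrite E normc0 ltxx.
have [rY rY'] := pencil_mreg hY.
have i0 : ('i%C : R[i]) != 0 by rewrite eq_complex /= oner_eq0 andbF.
have ni : normc ('i%C : R[i]) = 1 by rewrite /normc /= expr0n expr1n add0r sqrtr1.
have ki : - 'i%C * rho = - ('i%C * rho) by rewrite mulNr.
have rhok : rho ^+ 2 = - ('i%C * rho) ^+ 2 by rewrite exprMn sqr_i mulN1r opprK.
have nk : normc ('i%C * rho) = normc rho by rewrite normcM ni mul1r.
have k0 : 'i%C * rho != 0 by rewrite mulf_neq0.
have Rek : complex.Re ('i%C * rho) = - complex.Im rho.
  by rewrite Re_mul /= mul0r mul1r sub0r.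
have k2 : 2 * 'i%C * rho = 2 * ('i%C * rho) by rewrite mulrA.
rewrite k2 rhok in rY'; rewrite ki.
move: ('i%C * rho) rhok nk k0 Rek Y'0 rY' => k rhok nk k0 Rek Y'0 rY'.
have {}rY' : mreg (mxderive Y) (fun x => k ^+ 2 *: Y x - (2 * k) *: (Q1 x *m Y x) - Q0 x *m Y x).
  apply: mreg_eq rY' (fun=> erefl) _ => y.
  by rewrite !mulmxDl mul_scalar_mx -scalemxAl scaleNr !opprD opprK.
(* Since Re (i rho) = - Im rho, this is the least weight for which both diagonal coefficients have
   nonpositive real part. *)
pose t := `|complex.Im rho|.
have [U [V [rU rV [U0 V0] E]]] := split_mreg t k0 rY rY' Y0 Y'0.
have R1 : complex.Re (k - t%:C) <= 0.
  by rewrite Re_add Rek /= subr_le0 /t -normrN ler_norm.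
have R2 : complex.Re (- k - t%:C) <= 0.
  have Nk : complex.Re (- k) = complex.Im rho by rewrite -[RHS]opprK -Rek; case: (k).
  by rewrite Re_add Nk /= subr_le0 ler_norm.
rewrite -nk in rrho; have [F1 F2] := hK k al be t U V rrho R1 R2 rU rV U0 V0 x Ix.
have [-> ->] := E x.
have -> : cexp (k * x%:C) = cexp (t%:C * x%:C) * cexp ((k - t%:C) * x%:C).
  by rewrite -cexpD -mulrDl addrC subrK.
have -> : cexp (- k * x%:C) = cexp (t%:C * x%:C) * cexp ((- k - t%:C) * x%:C).
  by rewrite -cexpD -mulrDl addrC subrK.
have nW : normc (cexp (t%:C * x%:C)) = expR (t * x).
  by rewrite normc_cexp Re_mul /= mulr0 subr0.
rewrite -/t -nW -nk.
have nW0 := normc_ge0 (cexp (t%:C * x%:C)).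
split.
  rewrite (factor_sum _ _ _ _ (mulrCA _ _ _) (mulrCA _ _ _)) mx1normZ mulrC.
  rewrite ler_wpM2r //; apply: le_trans (mx1normD _ _) _.
  by clear - F1 F2; lra.
rewrite -scalerA -scalerBr (factor_diff _ _ _ _ (mulrCA _ _ _) (mulrCA _ _ _)) !mx1normZ.
rewrite mulrCA mulrC ler_wpM2r //.
have nk0 : 0 < normc k by rewrite nk.
apply: le_trans (_ : normc k * (2 * K * ((normc al + normc be) / normc k)) <= _); last first.
  by rewrite le_eqVlt; apply/orP; left; apply/eqP; field; exact: lt0r_neq0.
rewrite ler_wpM2l ?normc_ge0 //; apply: le_trans (mx1normD _ _) _; rewrite mx1normN.
by clear - F1 F2; lra.
Qed.

End Main.

Theorem theorem2 (R : realType) (m : nat) (hm : (1 <= m)%N)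
  (Q0 Q1 : R -> 'M[R[i]]_m)
  (hQ0 : forall i j, W1 0 (entry Q0 i j))
  (hQ1 : forall i j, W1 1 (entry Q1 i j))
  (Pplus Pminus : R -> 'M[R[i]]_m)
  (hPplus : is_cauchy_solution Q1 Pplus)
  (hPminus : is_cauchy_solution (fun x => - Q1 x) Pminus)
  (C S : R -> R[i] -> 'M[R[i]]_m)
  (hC : forall rho, is_pencil_solution Q1 Q0 rho (C^~ rho))
  (hS : forall rho, is_pencil_solution Q1 Q0 rho (S^~ rho))
  (hC0 : forall rho, C 0 rho = 1%:M /\ mxderive (C^~ rho) 0 = 0)
  (hS0 : forall rho, S 0 rho = 0 /\ mxderive (S^~ rho) 0 = 1%:M)
  (nu : nat) (hnu : (nu <= 1)%N) :
  bigO_unif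
    (fun x rho => mxderiven nu (C^~ rho) x -
       ((('i%C * rho) ^+ nu / 2 * cexp ('i%C * rho * x%:C)) *: Pminus x +
        ((- 'i%C * rho) ^+ nu / 2 * cexp (- 'i%C * rho * x%:C)) *: Pplus x))
    (fun x rho => normc rho ^ (nu%:Z - 1) * expR (`|complex.Im rho| * x))
  /\
  bigO_unif
    (fun x rho => mxderiven nu (S^~ rho) x -
       ((('i%C * rho) ^ (nu%:Z - 1) / 2 * cexp ('i%C * rho * x%:C)) *: Pminus x +
        ((- 'i%C * rho) ^ (nu%:Z - 1) / 2 * cexp (- 'i%C * rho * x%:C)) *: Pplus x))
    (fun x rho => normc rho ^ (nu%:Z - 2) * expR (`|complex.Im rho| * x)).
Proof.
have [K [r [r0 hK]]] := pencil_asymptotics hQ0 hQ1 hPplus hPminus.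
have n2 : normc (2^-1 : R[i]) = 2^-1.
  by rewrite normcV (_ : 2 = 2%:C) ?normc_real ?ger0_norm // rmorph_nat.
have two0 : (2 : R[i]) != 0 by rewrite pnatr_eq0.
have half1 : 2^-1 + 2^-1 = 1 :> R[i] by rewrite -mulr2n -[X in X *+ 2]mulr1 -mulrnAr mulVf.
have ki (rho : R[i]) : - 'i%C * rho = - ('i%C * rho) by rewrite mulNr.
have i0 : ('i%C : R[i]) != 0 by rewrite eq_complex /= oner_eq0 andbF.
have ni : normc ('i%C : R[i]) = 1 by rewrite /normc /= expr0n expr1n add0r sqrtr1.
have rho0 (rho : R[i]) : r <= normc rho -> 0 < normc rho /\ 'i%C * rho != 0.
  move=> rr; have nr0 : 0 < normc rho by exact: lt_le_trans rr.
  by split=> //; rewrite mulf_neq0 //; apply/eqP => E; move: nr0; rewrite E normc0 ltxx.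
split; exists K, r => rho x rr Ix; have [nr0 k0] := rho0 _ rr.
  have [C0 C'0] := hC0 rho.
  (* The initial conditions of [C] amount to al = be = 1 / 2. *)
  have CE : C 0 rho = (2^-1 + 2^-1)%:M by rewrite C0 half1.
  have C'E : mxderive (C^~ rho) 0 = ('i%C * rho * (2^-1 - 2^-1))%:M.
    by rewrite C'0 subrr mulr0 raddf0.
  have := hK rho 2^-1 2^-1 (C^~ rho) rr (hC rho) CE C'E x Ix.
  have -> : normc (2^-1 : R[i]) + normc (2^-1 : R[i]) = 1 by rewrite n2; field.
  rewrite mulr1 mul1r => -[h0 h1].
  case: nu hnu => [|[|//]] _; apply: le_trans (mxnorm_le_mx1norm _) _.
    by rewrite /mxderiven /= !expr0 !mul1r sub0r exprN1 mulrA.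
  rewrite /mxderiven /= !expr1 subrr expr0z mul1r.
  move: h1; congr (mx1norm (_ - _) <= _); rewrite scalerBr -scaleNr !scalerA.
  by rewrite ki !mulNr !mulrA.
have [S0 S'0] := hS0 rho.
(* The initial conditions of [S] amount to al = - be = [k2]. *)
pose k2 := (2 * ('i%C * rho))^-1.
have SE : S 0 rho = (k2 - k2)%:M by rewrite S0 subrr raddf0.
have kk : 'i%C * rho * (k2 + k2) = 1.
  by rewrite /k2 invfM mulrC -mulrDl -mulrA mulVf // mulr1 half1.
have S'E : mxderive (S^~ rho) 0 = ('i%C * rho * (k2 - - k2))%:M.
  by rewrite S'0 opprK kk.
have := hK rho k2 (- k2) (S^~ rho) rr (hS rho) SE S'E x Ix.
(* This is the additional power of 1 / |rho| in the estimates for [S]. *)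
have -> : normc k2 + normc (- k2) = (normc rho)^-1.
  rewrite normcN /k2 invfM !normcM n2 normcV normcM ni mul1r; field.
  exact: lt0r_neq0.
move=> -[h0 h1].
have a1 : ('i%C * rho)^-1 / 2 = k2 by rewrite /k2 [RHS]invfM mulrC.
have a2 : (- 'i%C * rho)^-1 / 2 = - k2 by rewrite ki invrN mulNr a1.
have kk2 : 'i%C * rho * k2 = 2^-1 by rewrite /k2 invfM mulrCA mulfV // mulr1.
case: nu hnu => [|[|//]] _; apply: le_trans (mxnorm_le_mx1norm _) _.
  have e2 : normc rho ^ (0%:Z - 2) = (normc rho)^-1 / normc rho.
    by rewrite sub0r -[- 2]/(- 2%:Z) -exprnN expr2 invfM.
  by rewrite e2 /mxderiven /= sub0r !exprN1 a1 a2 mulrA.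
have e1 : normc rho ^ (1%:Z - 2) = (normc rho)^-1 by rewrite -exprN1.
have e2 (a b : R[i]) (A B : 'M[R[i]]_m) :
    ('i%C * rho) *: ((k2 * a) *: A - (- k2 * b) *: B) = (2^-1 * a) *: A + (2^-1 * b) *: B.
  by rewrite mulNr scaleNr opprK scalerDr !scalerA !mulrA kk2.
by rewrite e2 in h1; rewrite e1 /mxderiven /= subrr !expr0z !mul1r mulrA.
Qed.
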